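(* Let $\{\alpha_1,\dots,\alpha_n\}$ be an orthonormal set in $L_2[0,T]$, let $p_1,\dots,p_n$ be nonnegative integers, let $F(x)=\prod_{j=1}^n \langle \alpha_j,x\rangle^{2p_j}$ for $x\in C_0[0,T]$, and let $q$ be a nonzero real number. Then the $L_1$ analytic Fourier–Feynman transform $T_q^{(1)}(F)$ of $F$ exists and, for s-a.e. $y\in C_0[0,T]$, $$T_q^{(1)}(F)(y)=\prod_{j=1}^n \Bigl[ \sum_{s=0}^{p_j} {}_{2p_j} C_{2s}\, (2s-1)!!\,\Bigl(\frac{i}{q}\Bigr)^s \langle \alpha_j,y \rangle^{2p_j-2s} \Bigr].$$
   Context: $C_0[0,T]$ ($T>0$) is the space of real-valued continuous functions $x$ on $[0,T]$ with $x(0)=0$, with Wiener measure $m$ on the $\sigma$-algebra $\mathcal M$ of Wiener measurable sets. For $v\in L_2[0,T]$, $\langle v,x\rangle$ is the Paley–Wiener–Zygmund stochastic integral (Gaussian with mean $0$, variance $\|v\|_2^2$, linear in $x$). A set $B$ is scale-invariant measurable if $\rho B\in\mathcal M$ for all $\rho>0$, scale-invariant null if moreover $m(\rho B)=0$ for all $\rho>0$; ''s-a.e.'' means outside a scale-invariant null set. $\mathbb C_+=\{\lambda\in\mathbb C:\mathrm{Re}\,\lambda>0\}$, and $\lambda^{1/2}$ is the principal square root. For a functional $G$ on $C_0[0,T]$ such that $J(\lambda)=\int_{C_0[0,T]}G(\lambda^{-1/2}x)\,m(dx)$ exists for all $\lambda>0$, if there is a function $J^*$ analytic on $\mathbb C_+$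 with $J^*=J$ on $(0,\infty)$, then $J^*(\lambda)$ is the analytic Wiener integral $\int^{\mathrm{anw}_\lambda}G(x)\,m(dx)$. For $\lambda\in\mathbb C_+$ and $y\in C_0[0,T]$, $T_\lambda(F)(y)=\int^{\mathrm{anw}_\lambda}_{C_0[0,T]}F(y+x)\,m(dx)$, and the $L_1$ analytic Fourier–Feynman transform is $T_q^{(1)}(F)(y)=\lim_{\lambda\to -iq,\ \lambda\in\mathbb C_+}T_\lambda(F)(y)$ for s-a.e. $y$. ${}_nC_k=\frac{n!}{k!(n-k)!}$; $(2s-1)!!=(2s-1)(2s-3)\cdots3\cdot1$ for $s\ge1$, $(-1)!!=1$. *)

(* Defs.v *)
From HB Require Import structures.
From mathcomp Require Import all_boot all_order all_algebra.
From mathcomp Require Import all_classical all_reals all_analysis.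
From mathcomp Require Import complex.
Set Implicit Arguments.
Unset Strict Implicit.
Unset Printing Implicit Defensive.
Import Order.TTheory GRing.Theory Num.Theory.
Import numFieldTopology.Exports numFieldNormedType.Exports.
Local Open Scope ring_scope.
Local Open Scope classical_set_scope.

Section WienerDefs.
Context {R : realType}.

Definition Cx : numFieldType := (R[i] : numFieldType).
Definition RtoC (x : R) : Cx := Complex x 0.
Definition iC : Cx := Complex 0 1.

(** [C0 T x] : x represents an element of C_0[0,T].  A path on [0,T] is
    represented by the function R -> R which is continuous, vanishes on
    (-oo,0] and is constant (= x T) on [T,+oo); this is a bijective
    encoding of C_0[0,T]. *)
Definition C0 (T : R) (x : R -> R) : Prop :=
  continuous x /\ (forall t, t <= 0 -> x t = 0) /\ (forall t, T <= t -> x t = x T).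

Definition L2ip (T : R) (u v : R -> R) : R :=
  \int[lebesgue_measure]_(t in `[0, T]) (u t * v t).

Definition inL2 (T : R) (u : R -> R) : Prop :=
  measurable_fun `[0, T] u /\
  lebesgue_measure.-integrable `[0, T] (fun t => ((u t) ^+ 2)%:E).

Definition L2orthonormal (T : R) (n : nat) (alpha : 'I_n -> R -> R) : Prop :=
  (forall j, inL2 T (alpha j)) /\
  (forall i j, L2ip T (alpha i) (alpha j) = (i == j)%:R).

(** A fixed complete orthonormal set of L_2[0,T] consisting of functions of
    bounded variation (the cosine basis). *)
Definition cons_basis (T : R) (k : nat) (t : R) : R :=
  if k == 0%N then (Num.sqrt T)^-1
  else Num.sqrt (2 / T) * cos (k%:R * pi * t / T).

Definition RS_sum (T : R) (phi x : R -> R) (N : nat) : R :=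
  \sum_(i < N) phi (i%:R * T / N%:R) *
               (x (i.+1%:R * T / N%:R) - x (i%:R * T / N%:R)).
Definition RS_int (T : R) (phi x : R -> R) : R := limn (RS_sum T phi x).

Definition PWZ_partial (T : R) (v x : R -> R) (N : nat) : R :=
  \sum_(k < N) L2ip T v (cons_basis T k) * RS_int T (cons_basis T k) x.
Definition PWZ (T : R) (v x : R -> R) : R :=
  if pselect (cvgn (PWZ_partial T v x)) then limn (PWZ_partial T v x) else 0.

(** Wiener measure: [X] is a (coordinate) map from the probability space
    (Omega, P) to C_0[0,T] whose law is Wiener measure, i.e. the
    increments over any partition 0 = t_0 < ... < t_k <= T are independent
    centered Gaussians with variances t_{i+1} - t_i. *)
Definition is_wiener {d : measure_display} {Omega : measurableType d}
    (T : R) (P : probability Omega R) (X : Omega -> R -> R) : Prop :=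
  [/\ (forall w, C0 T (X w)),
      (forall t, measurable_fun setT (fun w => X w t)) &
      (forall (k : nat) (t : nat -> R) (B : nat -> set R),
          t 0%N = 0 -> (forall i, (i < k)%N -> t i < t i.+1) -> t k <= T ->
          (forall i, measurable (B i)) ->
          P [set w | forall i, (i < k)%N -> B i (X w (t i.+1) - X w (t i))]
          = (\prod_(i < k) normal_prob 0 (Num.sqrt (t i.+1 - t i)) (B i))%E)].

Section WithMeasure.
Context {d : measure_display} {Omega : measurableType d}
        (P : probability Omega R) (X : Omega -> R -> R).

(** Wiener null set (null for the completed Wiener measure). *)
Definition wiener_null (B : set (R -> R)) : Prop :=
  exists A, measurable A /\ P A = 0%E /\ [set w | B (X w)] `<=` A.

Definition si_null (B : set (R -> R)) : Prop :=
  forall rho : R, 0 < rho -> wiener_null [set (fun t => rho * x t) | x in B].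

Definition wint_exists (G : (R -> R) -> Cx) : Prop :=
  P.-integrable setT (fun w => (complex.Re (G (X w)))%:E) /\
  P.-integrable setT (fun w => (complex.Im (G (X w)))%:E).
Definition wint (G : (R -> R) -> Cx) : Cx :=
  RtoC (\int[P]_(w in setT) complex.Re (G (X w)))
  + iC * RtoC (\int[P]_(w in setT) complex.Im (G (X w))).

Definition Cplus : set Cx := [set z | 0 < complex.Re z].

Definition analytic_on_Cplus (J : Cx -> Cx) : Prop :=
  forall z, Cplus z -> exists D : Cx, (fun h => (J (z + h) - J z) / h) @ 0^' --> D.

Definition scale_path (lam : R) (x : R -> R) : R -> R :=
  fun t => (Num.sqrt lam)^-1 * x t.

(** [T_lambda(F)(y)] exists for every lambda in C_+ (given by the analytic
    extension J of the Wiener integrals lambda |-> int F(y + lambda^{-1/2} x) m(dx),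
    lambda > 0), and T_q^{(1)}(F)(y) = lim_{lambda -> -iq, lambda in C_+} J(lambda)
    equals L. *)
Definition FFT1_at (F : (R -> R) -> Cx) (q : R) (y : R -> R) (L : Cx) : Prop :=
  (forall lam : R, 0 < lam ->
     wint_exists (fun x => F (fun t => y t + scale_path lam x t))) /\
  exists J : Cx -> Cx,
    [/\ analytic_on_Cplus J,
        (forall lam : R, 0 < lam ->
           J (RtoC lam) = wint (fun x => F (fun t => y t + scale_path lam x t))) &
        J z @[z --> within Cplus (nbhs (- iC * RtoC q))] --> L].

Definition FFT1_sae (T : R) (F : (R -> R) -> Cx) (q : R) (G : (R -> R) -> Cx) : Prop :=
  exists N : set (R -> R), si_null N /\
    forall y, C0 T y -> ~ N y -> FFT1_at F q y (G y).

End WithMeasure.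

(** Odd double factorial (2s-1)!! = 1 * 3 * ... * (2s-1), with (-1)!! = 1. *)
Definition odd_dfact (s : nat) : nat := \prod_(i < s) (2 * i + 1).

End WienerDefs.

(* Main.v *)
(** The Paley-Wiener-Zygmund integrals of an orthonormal family are jointly
    standard Gaussian, in the sense of moments: every linear combination
    [sum_j t_j <alpha_j, X>] has the moments of a centered Gaussian of variance
    [sum_j t_j^2], and the mixed moments are read off as coefficients of
    polynomials in the [t_j].  For Riemann-Stieltjes sums this is independence
    of the increments; it passes to the limit because a pointwise limit with
    bounded second moments commutes with expectation.  The variance in the limit
    is computed by Parseval's identity, i.e. by completeness of the cosine
    basis.  Almost sure convergence of the series defining [<alpha, X>] follows
    from a fourth-moment maximal inequality.  Finally
    [E prod_j (a_j + l^(-1/2) <alpha_j, X>)^(2 p_j)] is a polynomial in [1/l],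
    which is its own analytic continuation. *)

Require Import Defs.
From HB Require Import structures.
From mathcomp Require Import all_boot all_order all_algebra.
From mathcomp Require Import all_classical all_reals all_analysis.
From mathcomp Require Import complex.
From mathcomp Require Import measurable_realfun.
From mathcomp Require Import ring lra zify.
Set Implicit Arguments.
Unset Strict Implicit.
Unset Printing Implicit Defensive.
Import Order.TTheory GRing.Theory Num.Theory.
Import numFieldTopology.Exports numFieldNormedType.Exports.
Local Open Scope ring_scope.
Local Open Scope classical_set_scope.

(** * Moments of Gaussian variables *)

Section GaussMoments.
Context {R : realType}.
Implicit Types v w : R.

(** The functional is a polynomial in the stochastic integrals, so moments carry all the
    probabilistic information and no law of a limit has to be identified. The price is paid at the
    almost sure convergence: the cosine coordinates of a path are controlled only through moments of
    their linear combinations, so the convergence theorem for independent series is not at hand.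
    Chaining on second moments would not close, since the bounds for two halves of the variance add
    up to the bound for the whole; with fourth moments the bound is quadratic in the variance, and
    halving gains a factor. A second obstacle is that the stochastic integral takes the default
    value 0 where its series diverges. Integrability asks for measurability everywhere, so the
    shifted functional is also described on that null set. Completeness of the cosines is reached
    through indicators of rays, which are limits of polynomials in a single cosine; Dynkin's theorem
    and simple functions do the rest. Odd Gaussian moments vanish, so only even powers of
    lambda^(-1/2) survive and no branch of the square root enters the continuation. *)

Definition gaussm (v : R) (m : nat) : R :=
  if odd m then 0 else (odd_dfact m./2)%:R * v ^+ m./2.

Lemma odd_dfactS s : odd_dfact s.+1 = ((2 * s + 1) * odd_dfact s)%N.
Proof. by rewrite /odd_dfact big_ord_recr/= mulnC. Qed.

Lemma gaussm0 v : gaussm v 0 = 1.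
Proof. by rewrite /gaussm/= /odd_dfact big_ord0 expr0 mulr1. Qed.

Lemma gaussm1 v : gaussm v 1 = 0.
Proof. by []. Qed.

(** This is Gaussian integration by parts. With [gaussm0] and [gaussm1] it determines the moments,
    so later identifications only have to verify the recursion. *)
Lemma gaussmSS v m : gaussm v m.+2 = m.+1%:R * v * gaussm v m.
Proof.
rewrite /gaussm/= negbK; have [|em] := boolP (odd m); first by rewrite mulr0.
rewrite odd_dfactS natrM exprS.
have -> : (2 * m./2 + 1)%N = m.+1 by have := odd_double_half m; lia.
by ring.
Qed.

Lemma gaussmZ (b : R) v k : gaussm (b ^+ 2 * v) k = b ^+ k * gaussm v k.
Proof.
rewrite /gaussm; case: ifPn; first by rewrite mulr0.
move=> ok; rewrite exprMn -exprM mulrCA; congr (_ ^+ _ * _).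
by have := odd_double_half k; rewrite (negbTE ok) add0n -mul2n.
Qed.

(** Pascal's rule inside a binomial sum; [f] depends on both exponents so that the two halves can be
    treated separately. *)
Lemma sum_binS (f : nat -> nat -> R) m :
  \sum_(k < m.+2) 'C(m.+1, k)%:R * f k (m.+1 - k)%N =
  \sum_(k < m.+1) 'C(m, k)%:R * (f k.+1 (m - k)%N + f k (m - k).+1).
Proof.
under [RHS]eq_bigr do rewrite mulrDr.
rewrite big_split/= big_ord_recl/= bin0 mul1r.
under eq_bigr => i _.
  rewrite /bump /= add1n binS natrD mulrDl subSS; over.
rewrite big_split/= addrCA [LHS]addrC -addrA addrCA; congr (_ + _).
rewrite [in RHS]big_ord_recl/= bin0 mul1r !subn0; congr (_ + _).
rewrite big_ord_recr/= bin_small// mul0r addr0.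
by apply: eq_bigr => i _; rewrite /bump/= add1n -subSn.
Qed.

(** These are the moments of a sum of two independent centered Gaussians, obtained from the
    recursion alone by a two-step induction. *)
Lemma gaussmD v w m :
  \sum_(k < m.+1) 'C(m, k)%:R * (gaussm v k * gaussm w (m - k)) =
  gaussm (v + w) m.
Proof.
(* The half of Pascal's splitting that raises the first index: the factor i+1 from [gaussmSS] is
   absorbed by (i+1) C(n+1, i+1) = (n+1) C(n, i). The symmetry [sw] reduces the other half to this
   one. *)
have step n : (forall v w, \sum_(k < n.+1) 'C(n, k)%:R *
    (gaussm v k * gaussm w (n - k)) = gaussm (v + w) n) ->
  forall v w, \sum_(k < n.+2) 'C(n.+1, k)%:R *
    (gaussm v k.+1 * gaussm w (n.+1 - k)) = n.+1%:R * v * gaussm (v + w) n.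
  move=> IH v' w'; rewrite big_ord_recl/= gaussm1 mul0r mulr0 add0r.
  rewrite -IH mulr_sumr; apply: eq_bigr => i _.
  rewrite /bump /= add1n subSS gaussmSS.
  have /(congr1 (fun k => k%:R : R)) := mul_bin_diag n.+1 i.
  rewrite !natrM/= => e.
  transitivity (i.+1%:R * 'C(n.+1, i.+1)%:R * v' * gaussm v' i * gaussm w' (n - i)).
    by ring.
  by rewrite -e; ring.
have sw n (f g : nat -> R) : \sum_(k < n.+1) 'C(n, k)%:R * (f k * g (n - k)%N) =
    \sum_(k < n.+1) 'C(n, k)%:R * (g k * f (n - k)%N).
  rewrite (reindex_inj rev_ord_inj)/=; apply: eq_bigr => i _.
  rewrite subSS bin_sub ?subKn//; last by rewrite -ltnS.
    by rewrite [f _ * _]mulrC.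
  by rewrite -ltnS.
suff: forall n, (forall v w, \sum_(k < n.+1) 'C(n, k)%:R *
    (gaussm v k * gaussm w (n - k)) = gaussm (v + w) n) /\
  (forall v w, \sum_(k < n.+2) 'C(n.+1, k)%:R *
    (gaussm v k * gaussm w (n.+1 - k)) = gaussm (v + w) n.+1).
  by move=> /(_ m)[+ _]; exact.
elim => [|n [IH0 IH1]].
  split=> v' w'; first by rewrite big_ord1 !gaussm0 !mulr1.
  by rewrite !big_ord_recl big_ord0/= !gaussm1 !(mul0r,mulr0,add0r).
split=> // v' w'.
rewrite (sum_binS (fun a b => gaussm v' a * gaussm w' b)).
under eq_bigr do rewrite mulrDr.
rewrite big_split/= step//.
rewrite (sw n.+1 (gaussm v') (fun k => gaussm w' k.+1)) step// gaussmSS.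
by rewrite (addrC w'); ring.
Qed.

End GaussMoments.

(** * Integrals of derivatives over intervals and over the line *)

Section FTC.
Context {R : realType}.
Notation mu := (@lebesgue_measure R).

Lemma is_derive_continuous (F f : R -> R) :
  (forall x : R, is_derive x 1 F (f x)) -> continuous F.
Proof.
move=> dF x; apply/differentiable_continuous/derivable1_diffP.
by have [] := dF x.
Qed.

Lemma integral_is_derive (F f : R -> R) (a b : R) : a < b ->
  (forall x : R, is_derive x 1 F (f x)) -> continuous f ->
  (\int[mu]_(x in `[a, b]) (f x)%:E = (F b - F a)%:E)%E.
Proof.
move=> ab dF cf; have cF := is_derive_continuous dF.
rewrite (@continuous_FTC2 _ _ F)//.
- exact: continuous_subspaceT.
- split; [by move=> x _; have [] := dF x| |].
    by apply: cvg_at_right_filter; exact: cF.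
  by apply: cvg_at_left_filter; exact: cF.
- by move=> x _; rewrite derive1E; have [_ ->] := dF x.
Qed.

(** The fundamental theorem applies on each [-n, n], and |f| dominates the truncations. Applied to
    x^k times the normal density, this does the work of integration by parts. *)
Lemma integral_is_derive_eq0 (F f : R -> R) :
  (forall x : R, is_derive x 1 F (f x)) -> continuous f ->
  mu.-integrable setT (EFin \o f) ->
  F n%:R @[n --> \oo] --> 0 -> F (- n%:R) @[n --> \oo] --> 0 ->
  \int[mu]_x f x = 0.
Proof.
move=> dF cf intf F1 F2.
pose g n : R -> \bar R := (EFin \o f) \_ `[- n%:R, n%:R].
have mg n : measurable_fun setT (g n).
  apply/(measurable_restrictT _ _).1; first exact: measurable_itv.
  by apply/measurable_funTS/measurable_EFinP; exact: continuous_measurable_fun.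
have cg x : [set: R] x -> g n x @[n --> \oo] --> (f x)%:E.
  move=> _; apply: cvg_near_cst.
  exists (Num.truncn `|x|).+1 => // n /= xn.
  rewrite /g patchE ifT// inE/= in_itv/= -ler_norml.
  apply: ltW; apply: lt_le_trans (_ : (Num.truncn `|x|).+1%:R <= _).
    exact: truncnS_gt.
  by rewrite ler_nat.
have ig : mu.-integrable setT (abse \o (EFin \o f)) by exact: integrable_abse.
have lg n x : [set: R] x -> (`|g n x| <= (abse \o (EFin \o f)) x)%E.
  by move=> _; rewrite /g patchE; case: ifPn => //= _; rewrite normr0 lee_fin.
have fg x : [set: R] x -> (abse \o (EFin \o f)) x \is a fin_num by [].
have := @dominated_cvg _ _ _ mu _ measurableT _ _ _ mg cg fg ig lg.
have -> : (fun n => \int[mu]_x g n x)%E = (fun n => (F n%:R - F (- n%:R))%:E).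
  apply/funext => n; rewrite -integral_mkcond.
  have [->|n0] := eqVneq n 0%N.
    by rewrite oppr0 set_itv1 integral_set1 subrr.
  have n0' : 0 < n%:R :> R by rewrite ltr0n lt0n.
  by rewrite (@integral_is_derive F)// -subr_gt0 opprK addr_gt0.
move=> h; rewrite /Rintegral; move/cvg_lim : h => <-//.
have : (F n%:R - F (- n%:R))%:E @[n --> \oo] --> (0 - 0 : R)%:E.
  by apply: cvg_EFin; [exact: nearW|exact: cvgB].
by move/cvg_lim => ->//; rewrite subrr.
Qed.

End FTC.

Section NormalMoments.
Context {R : realType}.
Notation mu := (@lebesgue_measure R).
Implicit Types s x : R.

(** Doubling the variance halves the exponent: with y = x^2 / (4 s^2) the density decays like
    exp(-2y), and one factor exp(-y) is spent on the power of x through exp y >= 1 + y^(m+1) /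
    (m+1)!. *)
Lemma normal_pdf_le_sqrt2 s m : 0 < s ->
  exists2 C, 0 <= C & forall x,
    `|x| ^+ m * normal_pdf 0 s x <= C * normal_pdf 0 (Num.sqrt 2 * s) x.
Proof.
move=> s0; have s20 : 0 < Num.sqrt 2 * s by rewrite mulr_gt0// sqrtr_gt0.
rewrite !normal_pdfE ?gt_eqF//.
have p1 := normal_peak_gt0 (lt0r_neq0 s0).
have p2 := normal_peak_gt0 (lt0r_neq0 s20).
(* [K] comes from |x|^m <= 1 + (x^2)^(m+1) = 1 + (4 s^2)^(m+1) y^(m+1), each summand being bounded
   by a multiple of exp y. *)
pose K := 1 + (4 * s ^+ 2) ^+ m.+1 * (m.+1)`!%:R.
have K0 : 0 <= K by rewrite addr_ge0// mulr_ge0// exprn_ge0// mulr_ge0// sqr_ge0.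
exists (K * normal_peak s / normal_peak (Num.sqrt 2 * s)).
  by rewrite divr_ge0 ?mulr_ge0// ltW.
move=> x; rewrite mulrCA !mulrA.
rewrite divfK ?gt_eqF// -[leLHS]mulrA (mulrC K) -mulrA ler_pM2l//.
rewrite /normal_fun exprMn sqr_sqrtr// subr0.
set y := x ^+ 2 / (4 * s ^+ 2).
have y0 : 0 <= y by rewrite divr_ge0 ?sqr_ge0// mulr_ge0 ?sqr_ge0.
have -> : - x ^+ 2 / (s ^+ 2 *+ 2) = - y - y.
  by rewrite /y; field; rewrite gt_eqF.
have -> : - x ^+ 2 / ((2 * s ^+ 2) *+ 2) = - y.
  by rewrite /y; field; rewrite gt_eqF.
rewrite expRD mulrA ler_pM2r ?expR_gt0// expRN ler_pdivrMr ?expR_gt0//.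
have xm : `|x| ^+ m <= 1 + (x ^+ 2) ^+ m.+1.
  have [x1|x1] := leP `|x| 1.
    apply: (@le_trans _ _ 1); first by rewrite exprn_ile1.
    by rewrite lerDl exprn_ge0// sqr_ge0.
  rewrite -normrX -[x ^+ 2]real_normK ?num_real// -exprM normrX.
  apply: (@le_trans _ _ (`|x| ^+ (2 * m.+1))); last by rewrite lerDr.
  by apply: ler_weXn2l; [exact: ltW|lia].
apply: (le_trans xm).
have ey := expR_ge1Dxn m y0.
have ye : (x ^+ 2) ^+ m.+1 = (4 * s ^+ 2) ^+ m.+1 * y ^+ m.+1.
  by rewrite -exprMn /y mulrC divfK// mulf_neq0// ?expf_neq0// gt_eqF.
rewrite ye /K [leRHS]mulrDl mul1r.
apply: lerD.
  by apply: le_trans ey; rewrite lerDl divr_ge0// exprn_ge0.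
rewrite -mulrA; apply: ler_wpM2l; first by rewrite exprn_ge0// mulr_ge0// sqr_ge0.
rewrite mulrC -ler_pdivrMr ?ltr0n ?fact_gt0//.
by apply: le_trans ey; rewrite lerDr.
Qed.

Lemma integrable_X_normal_pdf s m : 0 < s ->
  mu.-integrable setT (fun x => (x ^+ m * normal_pdf 0 s x)%:E).
Proof.
move=> s0; have [C C0 CP] := normal_pdf_le_sqrt2 m s0.
have := integrableZl measurableT C (integrable_normal_pdf 0 (Num.sqrt 2 * s)).
apply: le_integrable => //.
  apply/measurable_EFinP; apply: measurable_funM => //.
  exact: measurable_normal_pdf.
move=> x _; rewrite /= lee_fin normrM normrX (ger0_norm (normal_pdf_ge0 _ _ _)).
by apply: (le_trans (CP x)); rewrite ler_norm.
Qed.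

Lemma is_derive_normal_pdf s x : s != 0 ->
  is_derive x 1 (normal_pdf 0 s) (- x / s ^+ 2 * normal_pdf 0 s x).
Proof.
move=> s0.
have -> : normal_pdf 0 s =
    (fun x => normal_peak s * (expR \o (fun y => - (s ^+ 2 *+ 2)^-1 * y ^+ 2)) x).
  rewrite normal_pdfE//; apply/funext => y; congr (_ * expR _).
  by rewrite subr0 !mulNr mulrC.
have h : is_derive x 1 (fun y => - (s ^+ 2 *+ 2)^-1 * y ^+ 2) (- x / s ^+ 2).
  apply: is_derive_eq; rewrite /GRing.scale/=; field; exact: s0.
have h2 := @is_derive1_comp _ expR _ x _ _ (is_derive_expR _) h.
apply: is_derive_eq; rewrite /GRing.scale/=; ring.
Qed.

Lemma normal_pdf_moment s m : 0 < s ->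
  \int[mu]_x (x ^+ m * normal_pdf 0 s x) = gaussm (s ^+ 2) m.
Proof.
move=> s0; have sN0 : s != 0 by rewrite gt_eqF.
pose J k := \int[mu]_x (x ^+ k * normal_pdf 0 s x).
have cp : continuous (normal_pdf 0 s) by exact: continuous_normal_pdf.
have cX k : continuous (fun x => x ^+ k * normal_pdf 0 s x).
  by move=> x; apply: cvgM; [exact: exprn_continuous|exact: cp].
have lim0 (u : R^nat) k : (forall n, `|u n| = n%:R) ->
    u n ^+ k * normal_pdf 0 s (u n) @[n --> \oo] --> 0.
  (* The bound is taken for one power more than needed; the surplus power leaves the decay 1/n. *)
  move=> un; have [C C0 CP] := normal_pdf_le_sqrt2 k.+1 s0.
  set D := C * normal_peak (Num.sqrt 2 * s).
  apply/norm_cvg0P.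
  apply: (@squeeze_cvgr _ _ _ _ (cst 0) (fun n => D * n%:R^-1)).
  - exists 1%N => // n /= n0; rewrite normr_ge0/=.
    have n0' : 0 < n%:R :> R by rewrite ltr0n.
    rewrite ler_pdivlMr// -(un n) normrM normrX mulrAC -exprSr.
    rewrite (ger0_norm (normal_pdf_ge0 _ _ _)).
    apply: (le_trans (CP _)); rewrite ler_wpM2l// normal_pdf_ub//.
    by rewrite mulf_neq0// gt_eqF// sqrtr_gt0.
  - exact: cvg_cst.
  - rewrite -[X in _ --> X](mulr0 D); apply: cvgM; first exact: cvg_cst.
    apply/gtr0_cvgV0; last exact: cvgr_idn.
    by exists 1%N => // n /= n0; rewrite ltr0n.
(* The function [f] is the derivative of x^k times the density, so its integral vanishes. At k = 0
   the truncated predecessor is harmless because its coefficient is 0. *)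
have rec k : J k.+1 = k%:R * s ^+ 2 * J k.-1.
  pose f x := k%:R * (x ^+ k.-1 * normal_pdf 0 s x)
              + (- s ^- 2) * (x ^+ k.+1 * normal_pdf 0 s x).
  have i1 := integrable_X_normal_pdf k.-1 s0.
  have i2 := integrable_X_normal_pdf k.+1 s0.
  have j1 := integrableZl measurableT k%:R i1.
  have j2 := integrableZl measurableT (- s ^- 2) i2.
  have : \int[mu]_x f x = 0.
    apply: (@integral_is_derive_eq0 _ (fun x => x ^+ k * normal_pdf 0 s x)).
    - move=> x; have dp := is_derive_normal_pdf x sN0.
      have -> : (fun x => x ^+ k * normal_pdf 0 s x) =
          ((id : R -> R) ^+ k * normal_pdf 0 s).
        by apply/funext => y; rewrite !fctE.
      apply: (is_derive_eq (is_deriveM (is_deriveX k (is_derive_id x 1)) dp)).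
      rewrite /f /GRing.scale/= !fctE [x ^+ k.+1]exprS.
      set a := x ^+ k; set b := x ^+ k.-1; set c := normal_pdf 0 s x.
      by field.
    - move=> x; apply: cvgD; apply: cvgM; (try exact: cvg_cst); exact: cX.
    - exact: (integrableD measurableT j1 j2).
    - by apply: lim0 => n; rewrite normr_nat.
    - by apply: (lim0 (fun n => - n%:R)) => n; rewrite normrN normr_nat.
  rewrite RintegralD//.
  rewrite (RintegralZl _ measurableT i1) (RintegralZl _ measurableT i2) -/(J _) -/(J _).
  move/eqP; rewrite addr_eq0 mulNr opprK => /eqP e.
  by rewrite mulrAC e mulrC mulrA divff ?expf_neq0// mul1r.
have J0 : J 0%N = 1.
  rewrite /J /Rintegral.
  by under eq_integral do rewrite expr0 mul1r; rewrite integral_normal_pdf.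
rewrite -/(J m).
suff: J m = gaussm (s ^+ 2) m /\ J m.+1 = gaussm (s ^+ 2) m.+1 by case.
elim: m => [|m [IH1 IH2]].
  by rewrite J0 gaussm0 rec !mul0r gaussm1.
by split=> //; rewrite rec/= IH1 gaussmSS.
Qed.

End NormalMoments.

(** * Integration lemmas *)

Section RealIntegrals.
Context d (T : measurableType d) (R : realType) (mu : {measure set T -> \bar R}).
Variables (D : set T) (mD : measurable D).
Implicit Types f g h : T -> R.

Lemma EFin_Rintegral f : mu.-integrable D (EFin \o f) ->
  (\int[mu]_(x in D) f x)%:E = (\int[mu]_(x in D) (f x)%:E)%E.
Proof. by move=> fi; rewrite /Rintegral fineK//; exact: integrable_fin_num. Qed.

Lemma integrableD_EFin f g : mu.-integrable D (EFin \o f) ->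
  mu.-integrable D (EFin \o g) -> mu.-integrable D (EFin \o (fun x => f x + g x)).
Proof. by move=> fi gi; exact: (integrableD mD fi gi). Qed.

Lemma integrableB_EFin f g : mu.-integrable D (EFin \o f) ->
  mu.-integrable D (EFin \o g) -> mu.-integrable D (EFin \o (fun x => f x - g x)).
Proof. by move=> fi gi; exact: (integrableB mD fi gi). Qed.

Lemma integrableZ_EFin f k : mu.-integrable D (EFin \o f) ->
  mu.-integrable D (EFin \o (fun x => k * f x)).
Proof. by move=> fi; exact: (integrableZl mD k fi). Qed.

Lemma integrable_sum_EFin (I : Type) (s : seq I) (h : I -> T -> R) :
  (forall i, mu.-integrable D (EFin \o h i)) ->
  mu.-integrable D (EFin \o (fun x => \sum_(i <- s) h i x)).
Proof.
move=> hi; elim: s => [|i s IH].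
  rewrite (_ : _ \o _ = cst 0%E); first exact: integrable0.
  by apply/funext => x /=; rewrite big_nil.
rewrite (_ : _ \o _ = EFin \o (fun x => h i x + \sum_(j <- s) h j x)).
  exact: integrableD_EFin.
by apply/funext => x /=; rewrite big_cons.
Qed.

Lemma Rintegral_sum (I : Type) (s : seq I) (h : I -> T -> R) :
  (forall i, mu.-integrable D (EFin \o h i)) ->
  \int[mu]_(x in D) (\sum_(i <- s) h i x) =
  \sum_(i <- s) \int[mu]_(x in D) h i x.
Proof.
move=> hi; elim: s => [|i s IH].
  rewrite big_nil; under eq_Rintegral do rewrite big_nil.
  by rewrite /Rintegral integral0.
rewrite big_cons -IH -RintegralD//; last exact: integrable_sum_EFin.
by apply: eq_Rintegral => x _; rewrite big_cons.
Qed.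

Lemma Rdominated_cvg (f_ : nat -> T -> R) f g :
  (forall n, measurable_fun D (f_ n)) -> measurable_fun D f ->
  {ae mu, forall x, D x -> f_ n x @[n --> \oo] --> f x} ->
  mu.-integrable D (EFin \o g) ->
  (forall n x, D x -> `|f_ n x| <= g x) ->
  mu.-integrable D (EFin \o f) /\
  \int[mu]_(x in D) f_ n x @[n --> \oo] --> \int[mu]_(x in D) f x.
Proof.
move=> mf_ mf cf ig fg.
have [] // := @dominated_convergence _ _ _ mu _ mD (fun n => EFin \o f_ n)
  (EFin \o f) (EFin \o g).
- by move=> n; apply/measurable_EFinP.
- by apply/measurable_EFinP.
- apply: filterS cf => x + Dx => /(_ Dx) h.
  by apply: cvg_EFin; [exact: nearW|exact: h].
- by apply: aeW => x n Dx; rewrite /= lee_fin fg.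
move=> fi _ h; split=> //; apply: (fine_cvg); rewrite /=.
by rewrite EFin_Rintegral.
Qed.

Lemma Rdominated_cvg_sqr (v_ : nat -> T -> R) (u h : T -> R) :
  (forall n, measurable_fun D (v_ n)) -> measurable_fun D u ->
  {ae mu, forall x, D x -> v_ n x @[n --> \oo] --> u x} ->
  mu.-integrable D (EFin \o h) ->
  (forall n x, D x -> (u x - v_ n x) ^+ 2 <= h x) ->
  \int[mu]_(x in D) (u x - v_ n x) ^+ 2 @[n --> \oo] --> 0.
Proof.
move=> mv mu' vu ih uvh.
have mf n : measurable_fun D (fun t => (u t - v_ n t) ^+ 2).
  by apply: measurable_funX; apply: measurable_funB.
have cf : {ae mu, forall t, D t -> (u t - v_ n t) ^+ 2 @[n --> \oo] --> (cst 0 t : R)}.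
  apply: filterS vu => t + Dt => /(_ Dt) vt.
  rewrite /cst -(mulr0 (0 : R)) -(subrr (u t)).
  under eq_fun do rewrite expr2.
  by apply: cvgM; apply: cvgB => //; exact: cvg_cst.
have bf n t : D t -> `|(u t - v_ n t) ^+ 2| <= h t.
  by move=> Dt; rewrite ger0_norm ?sqr_ge0//; exact: uvh.
have m0 : measurable_fun D (cst 0 : T -> R) by [].
have [_] := Rdominated_cvg mf m0 cf ih bf.
by rewrite Rintegral_cst// mul0r.
Qed.

Lemma ae_eq_Rintegral f g : measurable_fun D f -> measurable_fun D g ->
  {ae mu, forall x, D x -> f x = g x} ->
  \int[mu]_(x in D) f x = \int[mu]_(x in D) g x.
Proof.
move=> mf mg fg; rewrite /Rintegral; congr fine.
apply: ae_eq_integral => //; [exact/measurable_EFinP|exact/measurable_EFinP|].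
by apply: filterS fg => x + Dx => /(_ Dx) ->.
Qed.

Lemma integrable_bounded_mul f h K : mu.-integrable D (EFin \o f) ->
  measurable_fun D h -> (forall x, D x -> `|h x| <= K) ->
  mu.-integrable D (EFin \o (fun x => f x * h x)).
Proof.
move=> fi mh hK.
apply: (@le_integrable _ _ _ _ _ mD _ (EFin \o (fun x => K * f x))).
- apply/measurable_EFinP; apply: measurable_funM => //.
  by apply/measurable_EFinP; exact: measurable_int fi.
- move=> x Dx; rewrite /= lee_fin !normrM mulrC ler_wpM2r//.
  by rewrite (le_trans (hK _ Dx))// ler_norm.
- exact: integrableZ_EFin.
Qed.

End RealIntegrals.

(** * The algebra of random variables with all moments *)

Section AllMoments.
Context d (T : measurableType d) (R : realType) (P : probability T R).
Implicit Types f g : T -> R.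

(** Asking for every power at once makes the class an algebra: closure under products needs only
    |ab| <= a^2 + b^2, since doubling an exponent stays inside the class. *)
Definition all_moments f := measurable_fun setT f /\
  forall m, P.-integrable setT (EFin \o (fun w => f w ^+ m)).

Lemma all_moments_int f : all_moments f -> P.-integrable setT (EFin \o f).
Proof. by move=> [_ /(_ 1%N)]. Qed.

Lemma all_moments_cst c : all_moments (cst c).
Proof.
split=> // m; exact: (finite_measure_integrable_cst _ (c ^+ m)).
Qed.

Lemma le_normM_sqrD (a b : R) : `|a * b| <= a ^+ 2 + b ^+ 2.
Proof.
have := sqr_ge0 (`|a| - `|b|); rewrite sqrrB !real_normK ?num_real// normrM => h.
have : 0 <= `|a| * `|b| by rewrite mulr_ge0.
by move: h; rewrite mulr2n; lra.
Qed.

Lemma all_momentsM f g : all_moments f -> all_moments g ->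
  all_moments (fun w => f w * g w).
Proof.
move=> [mf fi] [mg gi]; split; first exact: measurable_funM.
move=> m.
apply: (@le_integrable _ _ _ _ _ measurableT _
  (EFin \o (fun w => f w ^+ (m * 2) + g w ^+ (m * 2)))) => //.
- by apply/measurable_EFinP; apply: measurable_funX; exact: measurable_funM.
- move=> w _; rewrite /= lee_fin exprMn (le_trans (le_normM_sqrD _ _))//.
  by rewrite -!exprM ler_norm.
- by apply: integrableD_EFin.
Qed.

Lemma all_momentsD f g : all_moments f -> all_moments g ->
  all_moments (fun w => f w + g w).
Proof.
move=> [mf fi] [mg gi]; split; first exact: measurable_funD.
move=> m.
apply: (@le_integrable _ _ _ _ _ measurableT _
  (EFin \o (fun w => 2 ^+ m * (`|f w ^+ m| + `|g w ^+ m|)))) => //.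
- by apply/measurable_EFinP; apply: measurable_funX; exact: measurable_funD.
- move=> w _; rewrite /= lee_fin !normrX (le_trans _ (ler_norm _))//.
  set M := Num.max `|f w| `|g w|.
  apply: (@le_trans _ _ ((2 * M) ^+ m)).
    rewrite lerXn2r ?nnegrE// ?mulr_ge0 ?le_max ?normr_ge0//.
    rewrite (le_trans (ler_normD _ _))// mulr_natl mulr2n.
    by rewrite lerD// /M le_max lexx ?orbT.
  rewrite exprMn ler_wpM2l// ?exprn_ge0//.
  have fm : 0 <= `|f w| ^+ m by rewrite exprn_ge0.
  have gm : 0 <= `|g w| ^+ m by rewrite exprn_ge0.
  by rewrite /M /Order.max; case: ifP => _; rewrite ?lerDl ?lerDr.
- apply: integrableZ_EFin => //; apply: integrableD_EFin => //.
    exact: (integrable_norm (fi m)).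
  exact: (integrable_norm (gi m)).
Qed.

Lemma all_momentsZ f c : all_moments f -> all_moments (fun w => c * f w).
Proof. by move=> fL; apply: all_momentsM => //; exact: all_moments_cst. Qed.

Lemma all_momentsX f n : all_moments f -> all_moments (fun w => f w ^+ n).
Proof.
move=> [mf fi]; split; first exact: measurable_funX.
move=> m; have := fi (n * m)%N; congr (P.-integrable _ _).
by apply/funext => w /=; rewrite exprM.
Qed.

Lemma all_moments_sum (I : Type) (s : seq I) (F : I -> T -> R) :
  (forall i, all_moments (F i)) -> all_moments (fun w => \sum_(i <- s) F i w).
Proof.
move=> FL; elim: s => [|i s IH].
  rewrite (_ : (fun _ => _) = cst 0); first exact: all_moments_cst.
  by apply/funext => w; rewrite big_nil.
rewrite (_ : (fun _ => _) = (fun w => F i w + \sum_(i <- s) F i w)).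
  exact: all_momentsD.
by apply/funext => w; rewrite big_cons.
Qed.

Lemma all_moments_prod (I : Type) (s : seq I) (F : I -> T -> R) :
  (forall i, all_moments (F i)) -> all_moments (fun w => \prod_(i <- s) F i w).
Proof.
move=> FL; elim: s => [|i s IH].
  rewrite (_ : (fun _ => _) = cst 1); first exact: all_moments_cst.
  by apply/funext => w; rewrite big_nil.
rewrite (_ : (fun _ => _) = (fun w => F i w * \prod_(i <- s) F i w)).
  exact: all_momentsM.
by apply/funext => w; rewrite big_cons.
Qed.

End AllMoments.

Section BoundedSecondMoment.
Context d (T : measurableType d) (R : realType) (P : probability T R).

(* Vitali's theorem in the easy case: with Z = |Y_n - Y| one has
   Z <= min(Z, k) + Z^2 / k. *)
Lemma cvg_expectation_L2_bounded (Y_ : nat -> T -> R) (Y : T -> R) (K : R) :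
  (forall n, all_moments P (Y_ n)) -> measurable_fun setT Y ->
  {ae P, forall w, Y_ n w @[n --> \oo] --> Y w} ->
  (forall n, \int[P]_w (Y_ n w ^+ 2) <= K) ->
  P.-integrable setT (EFin \o Y) /\
  \int[P]_w Y_ n w @[n --> \oo] --> \int[P]_w Y w.
Proof.
move=> LY mY cY bY.
have iY2 n : P.-integrable setT (EFin \o (fun w => Y_ n w ^+ 2)).
  by have [_] := LY n; exact.
have mY_ n : measurable_fun setT (Y_ n) by have [] := LY n.
(* By Fatou's lemma the limit inherits the bound on the second moments. *)
have Y2K : (\int[P]_w (Y w ^+ 2)%:E <= K%:E)%E.
  have -> : (\int[P]_w (Y w ^+ 2)%:E =
      \int[P]_w (limn_einf (fun n => (Y_ n w ^+ 2)%:E)))%E.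
    apply: ae_eq_integral => //.
    - by apply/measurable_EFinP; exact: measurable_funX.
    - rewrite (_ : (fun w => _) = (fun w =>
        - limn_esup (-%E \o (fun n => (Y_ n w ^+ 2)%:E)))%E); last first.
        by apply/funext => w; rewrite limn_esupN oppeK.
      apply: measurableT_comp => //; apply: measurable_fun_limn_esup => n.
      apply: measurableT_comp => //.
      by apply/measurable_EFinP; exact: measurable_funX.
    apply: filterS cY => w h _.
    have h2 : (Y_ n w ^+ 2)%:E @[n --> \oo] --> (Y w ^+ 2)%:E.
      apply: cvg_EFin; first exact: nearW.
      by rewrite expr2; under eq_fun do rewrite /= expr2; exact: cvgM.
    rewrite is_cvg_limn_einfE; last by apply/cvg_ex; eexists; exact: h2.
    by apply/esym/cvg_lim.
  apply: (@le_trans _ _ (limn_einf (fun n => \int[P]_w (Y_ n w ^+ 2)%:E)%E)).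
    apply: fatou => //.
    - by move=> n; apply/measurable_EFinP; exact: measurable_funX.
    - by move=> n w _; rewrite lee_fin sqr_ge0.
  rewrite limn_einf_lim; apply: lime_le; first exact: is_cvg_einfs.
  apply: nearW => n; apply: (@le_trans _ _ (\int[P]_w (Y_ n w ^+ 2)%:E)%E).
    by apply: ereal_inf_lbound; exists n => /=.
  by rewrite -EFin_Rintegral ?lee_fin//; exact: iY2.
have iY : P.-integrable setT (EFin \o (fun w => Y w ^+ 2)).
  apply/integrableP; split; first by apply/measurable_EFinP; exact: measurable_funX.
  under eq_integral => w _ do rewrite /= ger0_norm ?sqr_ge0//.
  by apply: (le_lt_trans Y2K); rewrite ltry.
have sq1 (x : R) : `|x| <= 1 + x ^+ 2.
  by have := sqr_ge0 (`|x| - 1); rewrite -[x ^+ 2]real_normK ?num_real//; nra.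
have i1 : P.-integrable setT (EFin \o (cst 1)).
  exact: (finite_measure_integrable_cst _ 1).
have iY1 : P.-integrable setT (EFin \o Y).
  apply: (@le_integrable _ _ _ _ _ measurableT _
    (EFin \o (fun w => 1 + Y w ^+ 2))) => //.
  - exact/measurable_EFinP.
  - by move=> w _; rewrite /= lee_fin (le_trans (sq1 _))// ler_norm.
  - by apply: integrableD_EFin.
split=> //.
have K0 : 0 <= K by apply: le_trans (bY 0%N); apply: Rintegral_ge0 => w _; exact: sqr_ge0.
have EYK : \int[P]_w (Y w ^+ 2) <= K by rewrite -lee_fin EFin_Rintegral.
pose Z n w : R := `|Y_ n w - Y w|.
have iYY n : P.-integrable setT (EFin \o (fun w => Y_ n w - Y w)).
  by apply: integrableB_EFin => //; exact: all_moments_int.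
have mZ n : measurable_fun setT (Z n).
  by apply: measurableT_comp => //; exact: measurable_funB.
have iZ n : P.-integrable setT (EFin \o Z n).
  exact: (integrable_norm (iYY n)).
have iZ2 n : P.-integrable setT (EFin \o (fun w => 2 * (Y_ n w ^+ 2 + Y w ^+ 2))).
  by apply: integrableZ_EFin => //; apply: integrableD_EFin.
(* The square of Y_n - Y is at most 2 (Y_n^2 + Y^2), whose mean is at most 4K. *)
have ZK n (k : R) : 0 < k ->
    \int[P]_w Z n w <= \int[P]_w (Num.min (Z n w) k) + 4 * K / k.
  move=> k0.
  have im : P.-integrable setT (EFin \o (fun w => Num.min (Z n w) k)).
    apply: (@le_integrable _ _ _ _ _ measurableT _ (EFin \o Z n)) => //.
      by apply/measurable_EFinP; apply: measurable_minr.
    move=> w _; rewrite /= lee_fin ger0_norm; last by rewrite le_min normr_ge0 ltW.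
    by rewrite ge_min ler_norm.
  apply: (@le_trans _ _ (\int[P]_w (Num.min (Z n w) k +
      k^-1 * (2 * (Y_ n w ^+ 2 + Y w ^+ 2))))).
    apply: le_Rintegral => //.
      by apply: integrableD_EFin => //; apply: integrableZ_EFin.
    move=> w _; have [zk|zk] := leP (Z n w) k.
      by rewrite lerDl mulr_ge0 ?invr_ge0 ?mulr_ge0 ?addr_ge0 ?sqr_ge0 ?ltW.
    apply: (@le_trans _ _ (k^-1 * (Z n w) ^+ 2)).
      rewrite mulrC ler_pdivlMr// expr2 ler_wpM2l// ?ltW//.
      exact: lt_trans zk.
    apply: (@le_trans _ _ (k^-1 * (2 * (Y_ n w ^+ 2 + Y w ^+ 2)))).
      rewrite ler_wpM2l ?invr_ge0 ?(ltW k0)// /Z real_normK ?num_real//.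
      rewrite -subr_ge0 (_ : _ - _ = (Y_ n w + Y w) ^+ 2) ?sqr_ge0//.
      by ring.
    by rewrite lerDr ltW.
  rewrite RintegralD//; last by apply: integrableZ_EFin.
  rewrite lerD2l RintegralZl// RintegralZl//; last by apply: integrableD_EFin.
  rewrite RintegralD//.
  rewrite mulrC ler_wpM2r ?invr_ge0 ?(ltW k0)//.
  by have := bY n; lra.
have cm (k : R) : 0 < k -> \int[P]_w (Num.min (Z n w) k) @[n --> \oo] --> (0 : R).
  move=> k0.
  have [] // := @Rdominated_cvg _ _ _ P _ measurableT
    (fun n w => Num.min (Z n w) k) (cst 0) (cst k).
  - by move=> n; apply: measurable_minr.
  - apply: filterS cY => w h _.
    have zw : Z n w @[n --> \oo] --> (0 : R).
      rewrite -(normr0 R) -(subrr (Y w)); apply: cvg_norm.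
      by apply: cvgB => //; exact: cvg_cst.
    apply: (@squeeze_cvgr _ _ _ _ (cst 0) (fun n => Z n w)); [|exact: cvg_cst|exact: zw].
    by apply: nearW => n; rewrite le_min normr_ge0 ltW//= ge_min lexx.
  - exact: (finite_measure_integrable_cst _ k).
  - move=> n w _; rewrite ger0_norm; last by rewrite le_min normr_ge0 ltW.
    by rewrite ge_min lexx orbT.
  by move=> _; rewrite Rintegral_cst// mul0r.
apply/cvgrPdist_lt => e e0.
have [k k0 Kk] : exists2 k : R, 0 < k & 4 * K / k < e / 2.
  have k0 : 0 < 8 * K / e + 1.
    by rewrite ltr_wpDl// divr_ge0 ?mulr_ge0// (ltW e0).
  exists (8 * K / e + 1) => //; rewrite ltr_pdivrMr//.
  have -> : e / 2 * (8 * K / e + 1) = 4 * K + e / 2 by field; rewrite gt_eqF.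
  by rewrite ltrDl divr_gt0.
have /cvgrPdist_lt/(_ (e / 2)) := cm k k0.
rewrite divr_gt0// => /(_ isT); apply: filterS => n.
rewrite sub0r normrN => h.
have -> : `|\int[P]_w Y w - \int[P]_w Y_ n w| = `|\int[P]_w (Y_ n w - Y w)|.
  by rewrite distrC RintegralB//; exact: all_moments_int.
apply: (@le_lt_trans _ _ (\int[P]_w Z n w)).
  exact: le_normr_Rintegral.
apply: (le_lt_trans (ZK n k k0)).
by rewrite (splitr e) ltrD// (le_lt_trans (ler_norm _) h).
Qed.

End BoundedSecondMoment.

(** * Moments of sums of independent increments *)

Section SimpleApproximation.
Context d (T : measurableType d) (R : realType).

Import HBSimple HBNNSimple.

(** Simple functions described by a plain list of coefficients, so that linearity becomes induction
    on a list; the sets are indexed by the coefficients themselves. *)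
Definition simple_form (f : T -> R) := exists (s : seq R) (A : R -> set T),
  (forall y, measurable (A y)) /\ forall x, f x = \sum_(y <- s) y * \1_(A y) x.

Lemma simple_form_measurable f : simple_form f -> measurable_fun setT f.
Proof.
move=> [s [A [mA fE]]].
rewrite (_ : f = (fun x => \sum_(y <- s) y * \1_(A y) x)); last exact/funext.
by apply: measurable_sum => y; apply: measurable_funM.
Qed.

Lemma simple_form_bounded f : simple_form f -> exists K, forall x, `|f x| <= K.
Proof.
move=> [s [A [mA fE]]]; exists (\sum_(y <- s) `|y|) => x.
rewrite fE; apply: (le_trans (ler_norm_sum _ _ _)).
apply: ler_sum => y _; rewrite normrM ler_piMr// indicE.
by case: (_ \in _); rewrite ?normr1 ?normr0.
Qed.

Lemma simple_approx (f : T -> R) : measurable_fun setT f -> (forall x, 0 <= f x) ->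
  exists f_ : nat -> T -> R, [/\ forall n, simple_form (f_ n),
    forall n x, 0 <= f_ n x, forall n x, f_ n x <= f x,
    forall x n m, (n <= m)%N -> f_ n x <= f_ m x &
    forall x, f_ n x @[n --> \oo] --> f x].
Proof.
move=> mf f0.
have mF : measurable_fun setT (EFin \o f) by exact/measurable_EFinP.
pose f_ n : T -> R := nnsfun_approx measurableT mF n.
have nd x n m : (n <= m)%N -> f_ n x <= f_ m x.
  by move=> nm; have /lefP := nd_nnsfun_approx measurableT mF nm; exact.
have cv x : f_ n x @[n --> \oo] --> f x.
  have : (f_ n x)%:E @[n --> \oo] --> (f x)%:E.
    by apply: (cvg_nnsfun_approx measurableT mF) => // y _; rewrite lee_fin.
  by move/fine_cvg.
exists f_; split => //.
- move=> n; pose g : {nnsfun T >-> R} := nnsfun_approx measurableT mF n.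
  exists (finmap.enum_fset (fset_set (range g))), (fun y => g @^-1` [set y]).
  split; first by move=> y; exact: measurable_sfunP.
  move=> x; rewrite -(@fsbig_finite _ _ _ _ (range g) (fun y => y * \1_(g @^-1` [set y]) x)) //.
  exact: (fimfunE g).
- move=> n x; rewrite -(cvg_lim _ (cv x))//.
  apply: nondecreasing_cvgn_le; first by move=> a b; exact: nd.
  by apply/cvg_ex; eexists; exact: cv.
Qed.

End SimpleApproximation.

(** * From product formulas on events to product formulas on functions *)

Section Decoupling.
Context d (T : measurableType d) (R : realType) (P : probability T R).
Notation mu := (@lebesgue_measure R).
Variables (xi : T -> R) (p : R -> R).
Hypotheses (mxi : measurable_fun setT xi) (p0 : forall x, 0 <= p x).
Hypothesis ip : mu.-integrable setT (EFin \o p).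

Let mp : measurable_fun setT p.
Proof. by apply/measurable_EFinP; exact: measurable_int ip. Qed.

Let integrable_mul_p (f : R -> R) : simple_form f ->
  mu.-integrable setT (EFin \o (fun x => f x * p x)).
Proof.
move=> sf; have [K fK] := simple_form_bounded sf.
rewrite (_ : (fun x => f x * p x) = (fun x => p x * f x)); last first.
  by apply/funext => x; rewrite mulrC.
apply: (@integrable_bounded_mul _ _ _ mu _ measurableT p f K) => //.
exact: simple_form_measurable.
Qed.

Let integrable_mul_xi (Y : T -> R) (f : R -> R) : simple_form f ->
  P.-integrable setT (EFin \o Y) ->
  P.-integrable setT (EFin \o (fun w => Y w * f (xi w))).
Proof.
move=> sf iY; have [K fK] := simple_form_bounded sf.
apply: (@integrable_bounded_mul _ _ _ P _ measurableT Y (f \o xi) K) => //; last first.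
  by move=> w _; exact: fK.
by apply: measurableT_comp => //; exact: simple_form_measurable.
Qed.

Section fixed_factor.
Variables (Y : T -> R) (c : R).
Hypothesis iY : P.-integrable setT (EFin \o Y).
Hypothesis H : forall B : set R, measurable B ->
  \int[P]_w (Y w * \1_B (xi w)) = c * \int[mu]_x (\1_B x * p x).

Let indic_simple (B : set R) : measurable B -> simple_form (\1_B : R -> R).
Proof.
move=> mB; exists [:: 1], (fun=> B); split => // x.
by rewrite big_seq1 mul1r.
Qed.

(** Hypothesis [H] expresses that [xi] has density [p] and is independent of the weight [Y], with
    [c] the mean of [Y] when [p] is a probability density. It is tested on indicators and extends by
    linearity. *)
Lemma decouple_simple (f : R -> R) : simple_form f ->
  \int[P]_w (Y w * f (xi w)) = c * \int[mu]_x (f x * p x).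
Proof.
move=> [s [A [mA fE]]].
have -> : \int[P]_w (Y w * f (xi w)) =
    \int[P]_w (\sum_(y <- s) y * (Y w * \1_(A y) (xi w))).
  apply: eq_Rintegral => w _; rewrite fE mulr_sumr.
  by apply: eq_bigr => y _; rewrite mulrCA.
have -> : \int[mu]_x (f x * p x) =
    \int[mu]_x (\sum_(y <- s) y * (\1_(A y) x * p x)).
  apply: eq_Rintegral => x _; rewrite fE mulr_suml.
  by apply: eq_bigr => y _; rewrite mulrA.
have i1 y : P.-integrable setT (EFin \o (fun w => Y w * \1_(A y) (xi w))).
  exact/integrable_mul_xi/iY/indic_simple.
have i2 y : mu.-integrable setT (EFin \o (fun x => \1_(A y) x * p x)).
  exact/integrable_mul_p/indic_simple.
rewrite Rintegral_sum//; last by move=> y; apply: integrableZ_EFin => //; exact: i1.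
rewrite Rintegral_sum//; last by move=> y; apply: integrableZ_EFin => //; exact: i2.
rewrite mulr_sumr; apply: eq_bigr => y _.
by rewrite (RintegralZl _ measurableT (i1 y)) (RintegralZl _ measurableT (i2 y)) H// mulrCA.
Qed.

(** [Y] may change sign, so the passage from simple functions uses dominated convergence, with |Y
    f(xi)| and f p as dominating functions. *)
Lemma decouple_ge0 (f : R -> R) : measurable_fun setT f -> (forall x, 0 <= f x) ->
  P.-integrable setT (EFin \o (fun w => Y w * f (xi w))) ->
  mu.-integrable setT (EFin \o (fun x => f x * p x)) ->
  \int[P]_w (Y w * f (xi w)) = c * \int[mu]_x (f x * p x).
Proof.
move=> mf f0 i1 i2; have [f_ [sf f_0 f_f nd cf]] := simple_approx mf f0.
have mf_ n : measurable_fun setT (f_ n) by exact: simple_form_measurable.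
have mY : measurable_fun setT Y by apply/measurable_EFinP; exact: measurable_int iY.
have [//|//|//|//||_ c1] := @Rdominated_cvg _ _ _ P _ measurableT
  (fun n w => Y w * f_ n (xi w)) (fun w => Y w * f (xi w))
  (fun w => `|Y w * f (xi w)|).
- by move=> n; apply: measurable_funM => //; exact: measurableT_comp.
- by apply: measurable_funM => //; exact: measurableT_comp.
- by apply: aeW => w _; apply: cvgM; [exact: cvg_cst|exact: cf].
- exact: (integrable_norm i1).
- move=> n w _; rewrite !normrM ler_wpM2l// !ger0_norm//.
have [//|//|//|//||_ c2] := @Rdominated_cvg _ _ _ mu _ measurableT
  (fun n x => f_ n x * p x) (fun x => f x * p x) (fun x => f x * p x).
- by move=> n; apply: measurable_funM; [exact: mf_|exact: mp].
- by apply: measurable_funM; [exact: mf|exact: mp].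
- by apply: aeW => w _; apply: cvgM; [exact: cf|exact: cvg_cst].
- by move=> n x _; rewrite ger0_norm ?mulr_ge0// ler_wpM2r.
have e : (fun n => \int[P]_w (Y w * f_ n (xi w))) =
    (fun n => c * \int[mu]_x (f_ n x * p x)).
  by apply/funext => n; exact: decouple_simple.
apply: (cvg_unique _ c1) => //; rewrite e.
by apply: cvgM => //; exact: cvg_cst.
Qed.

End fixed_factor.

Section law.
Hypothesis H : forall B : set R, measurable B ->
  P (xi @^-1` B) = (\int[mu]_(x in B) (p x)%:E)%E.

(** Integrability on the probability space is not yet known here, so convergence is monotone, with Y
    = 1 and c = 1. The finite moments of the increments come from this lemma. *)
Lemma law_integrable (f : R -> R) : measurable_fun setT f -> (forall x, 0 <= f x) ->
  mu.-integrable setT (EFin \o (fun x => f x * p x)) ->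
  P.-integrable setT (EFin \o (f \o xi)).
Proof.
move=> mf f0 i2; have [f_ [sf f_0 f_f nd cf]] := simple_approx mf f0.
have i1 : P.-integrable setT (EFin \o (cst 1)).
  exact: (finite_measure_integrable_cst _ 1).
have H1 (B : set R) : measurable B ->
    \int[P]_w (cst 1 w * \1_B (xi w)) = 1 * \int[mu]_x (\1_B x * p x).
  move=> mB; rewrite mul1r /Rintegral; congr fine.
  transitivity (\int[P]_w (\1_(xi @^-1` B) w)%:E)%E.
    by apply: eq_integral => w _; rewrite mul1r.
  rewrite integral_indic//; last by rewrite -[X in measurable X]setTI; exact: mxi.
  rewrite setIT; transitivity (\int[mu]_(x in B) (p x)%:E)%E; first exact: H.
  rewrite [LHS]integral_mkcond; apply: eq_integral => x _.
  by rewrite patchE indicE; case: (_ \in _); rewrite ?mul1r ?mul0r.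
apply/integrableP; split.
  by apply/measurable_EFinP; exact: measurableT_comp.
have mg n : measurable_fun setT (fun w => (f_ n (xi w))%:E).
  by apply/measurable_EFinP; apply: measurableT_comp => //; exact: simple_form_measurable.
have -> : (\int[P]_w `|(EFin \o (f \o xi)) w| =
    \int[P]_w limn (fun n => (f_ n (xi w))%:E))%E.
  apply: eq_integral => w _; rewrite /= ger0_norm//; apply/esym/cvg_lim => //.
  by apply: cvg_EFin; [exact: nearW|exact: cf].
rewrite monotone_convergence//; last 2 first.
- by move=> n w _; rewrite lee_fin.
- by move=> w _ n m nm; rewrite lee_fin; exact: nd.
apply: (@le_lt_trans _ _ (\int[mu]_x (f x * p x))%:E); last by rewrite ltry.
apply: lime_le.
  apply: ereal_nondecreasing_is_cvgn => n m nm; apply: ge0_le_integral => //.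
  - by move=> w _; rewrite lee_fin.
  - by move=> w _; rewrite lee_fin; exact: nd.
apply: nearW => n.
have -> : (\int[P]_w (f_ n (xi w))%:E = (\int[mu]_x (f_ n x * p x))%:E)%E.
  rewrite -[\int[mu]_x _]mul1r -(decouple_simple i1 H1 (sf n)) EFin_Rintegral//.
    by apply: eq_integral => w _; rewrite mul1r.
  exact: integrable_mul_xi.
rewrite lee_fin; apply: le_Rintegral => //; first exact: integrable_mul_p.
by move=> x _; rewrite ler_wpM2r.
Qed.

End law.
End Decoupling.

(** * Gaussian moments of linear combinations of increments *)

Section IndependentIncrements.
Context d (T : measurableType d) (R : realType) (P : probability T R).
Notation mu := (@lebesgue_measure R).
Variables (N : nat) (xi : nat -> T -> R) (sd : nat -> R) (a : nat -> R).
Hypothesis mxi : forall i, measurable_fun setT (xi i).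
Hypothesis sd0 : forall i, (i < N)%N -> 0 < sd i.
Hypothesis law : forall B : nat -> set R, (forall i, measurable (B i)) ->
  P [set w | forall i, (i < N)%N -> B i (xi i w)] =
  (\prod_(i < N) normal_prob 0 (sd i) (B i))%E.

Let Ev r (B : nat -> set R) := [set w | forall i, (r <= i < N)%N -> B i (xi i w)].
Let nu i (A : set R) : R := fine (normal_prob 0 (sd i) A).
Let S r w := \sum_(i < r) a i * xi i w.

Let nuE i A : measurable A -> normal_prob 0 (sd i) A = (nu i A)%:E.
Proof. by move=> mA; rewrite /nu fineK//; exact: fin_num_measure. Qed.

Let nuT i : nu i setT = 1.
Proof. by rewrite /nu probability_setT. Qed.

Let mEv r B : (forall i, measurable (B i)) -> measurable (Ev r B).
Proof.
move=> mB; rewrite (_ : Ev r B = \bigcap_i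
    (if (r <= i < N)%N then xi i @^-1` (B i) else setT)).
  apply: bigcapT_measurable => i; case: ifP => // _.
  by rewrite -[X in measurable X]setTI; exact: mxi.
apply/seteqP; split => w /=.
  by move=> h i _; case: ifP => // /h.
by move=> h i ri; have := h i I; rewrite ri.
Qed.

Let lawE B : (forall i, measurable (B i)) ->
  P (Ev 0 B) = (\prod_(0 <= i < N) nu i (B i))%:E.
Proof.
move=> mB; rewrite /Ev law// big_mkord (big_morph EFin EFinM erefl).
by apply: eq_bigr => i _; exact: (nuE i (mB i)).
Qed.

Let law1 i : (i < N)%N -> forall B : set R, measurable B ->
  P (xi i @^-1` B) = (\int[mu]_(x in B) (normal_pdf 0 (sd i) x)%:E)%E.
Proof.
move=> iN B mB; rewrite -/(normal_prob 0 (sd i) B).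
have -> : xi i @^-1` B = Ev 0 (fun j => if j == i then B else setT).
  apply/seteqP; split => w /=.
    by move=> h j _; case: ifP => // /eqP ->.
  by move=> /(_ i iN); rewrite eqxx.
rewrite lawE; last by move=> j; case: ifP.
rewrite (bigD1_seq i) ?mem_index_iota ?iota_uniq//= eqxx big1 ?mulr1 ?nuE//.
by move=> j /negPf ->; rewrite nuT.
Qed.

Let xi_moments i : (i < N)%N -> all_moments P (xi i).
Proof.
move=> iN; split => // m.
have ip := integrable_normal_pdf 0 (sd i).
have := @law_integrable _ _ _ P (xi i) _ (mxi i) (normal_pdf_ge0 0 (sd i)) ip
  (law1 iN) (fun x => 1 + x ^+ (m * 2)).
have mf : measurable_fun setT (fun x : R => 1 + x ^+ (m * 2)).
  by apply: measurable_funD => //; exact: measurable_funX.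
have f0 (x : R) : 0 <= 1 + x ^+ (m * 2) by rewrite addr_ge0// exprM sqr_ge0.
have ii : mu.-integrable setT
    (EFin \o (fun x => (1 + x ^+ (m * 2)) * normal_pdf 0 (sd i) x)).
  rewrite (_ : (fun x => _) = (fun x => normal_pdf 0 (sd i) x +
      x ^+ (m * 2) * normal_pdf 0 (sd i) x)).
    apply: integrableD_EFin => //.
    exact: (integrable_X_normal_pdf _ (sd0 iN)).
  by apply/funext => x; rewrite mulrDl mul1r.
move=> /(_ mf f0 ii); apply: le_integrable => //.
  by apply/measurable_EFinP; exact: measurable_funX.
move=> w _; rewrite /= lee_fin (ger0_norm (f0 _)).
have := sqr_ge0 (`|xi i w ^+ m| - 1); rewrite exprM.
by rewrite sqrrB real_normK ?num_real// mulr2n; have := normr_ge0 (xi i w ^+ m); lra.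
Qed.

Let S_moments r : (r <= N)%N -> all_moments P (S r).
Proof.
elim: r => [|r IH] rN.
  rewrite (_ : S 0 = cst 0); first exact: all_moments_cst.
  by apply/funext => w; rewrite /S big_ord0.
rewrite (_ : S r.+1 = (fun w => S r w + a r * xi r w)).
  by apply: all_momentsD; [exact/IH/ltnW|apply: all_momentsZ; exact: xi_moments].
by apply/funext => w; rewrite /S big_ord_recr.
Qed.

Let indic_int (E : set T) (Y : T -> R) : measurable E ->
  P.-integrable setT (EFin \o Y) ->
  P.-integrable setT (EFin \o (fun w => Y w * \1_E w)).
Proof.
move=> mE iY; apply: (@integrable_bounded_mul _ _ _ P _ measurableT Y (\1_E) 1) => //.
by move=> w _; rewrite indicE; case: (_ \in _); rewrite ?normr1 ?normr0.
Qed.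

(** In the assumed formula the set [B r] is arbitrary. Letting it vary gives the law of the r-th
    increment under the weight made of the earlier increments and of the events on the later ones;
    decoupling then replaces the indicator by a power. *)
Let step r : (r < N)%N ->
  (forall B m, (forall i, measurable (B i)) ->
    \int[P]_w (S r w ^+ m * \1_(Ev r B) w) =
    gaussm (\sum_(i < r) (a i * sd i) ^+ 2) m * \prod_(r <= i < N) nu i (B i)) ->
  forall B j k, (forall i, measurable (B i)) ->
    \int[P]_w (S r w ^+ j * \1_(Ev r.+1 B) w * xi r w ^+ k) =
    gaussm (\sum_(i < r) (a i * sd i) ^+ 2) j * \prod_(r.+1 <= i < N) nu i (B i)
    * gaussm (sd r ^+ 2) k.
Proof.
move=> rN IH B j k mB; have s0 := sd0 rN.
set c := _ * \prod_(_ <= _ < _) _.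
pose Y w := S r w ^+ j * \1_(Ev r.+1 B) w.
have LS := S_moments (ltnW rN); have Lx := xi_moments rN.
have iY : P.-integrable setT (EFin \o Y).
  apply: indic_int; first exact: mEv.
  by apply: all_moments_int; exact: all_momentsX.
have HY (C : set R) : measurable C ->
    \int[P]_w (Y w * \1_C (xi r w)) = c * \int[mu]_x (\1_C x * normal_pdf 0 (sd r) x).
  (* Inserting [C] at place [r] merges the indicator of [C] with the event on the later increments,
     so the assumed formula applies to [B']. *)
  move=> mC; pose B' i := if i == r then C else B i.
  have mB' i : measurable (B' i) by rewrite /B'; case: ifP.
  have -> : \int[mu]_x (\1_C x * normal_pdf 0 (sd r) x) = nu r C.
    rewrite /nu /normal_prob /Rintegral; congr fine.
    rewrite [RHS]integral_mkcond; apply: eq_integral => x _.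
    by rewrite patchE indicE; case: (_ \in _); rewrite ?mul1r ?mul0r.
  transitivity (\int[P]_w (S r w ^+ j * \1_(Ev r B') w)).
    apply: eq_Rintegral => w _; rewrite /Y -mulrA; congr (_ * _).
    rewrite !indicE -natrM mulnb; congr (_%:R); congr nat_of_bool.
    apply/idP/idP.
      move=> /andP[/set_mem h /set_mem hC]; apply/mem_set => i /andP[ri iN].
      rewrite /B'; case: ifPn => [/eqP -> //|ir]; apply: h.
      by rewrite iN andbT ltn_neqAle eq_sym ir.
    move=> /set_mem h; apply/andP; split; apply/mem_set.
      move=> i /andP[ri iN]; have := h i; rewrite iN (ltnW ri) => /(_ isT).
      by rewrite /B' gtn_eqF.
    by have := h r; rewrite leqnn rN => /(_ isT); rewrite /B' eqxx.
  rewrite IH// big_ltn// /B' eqxx mulrCA mulrC /c; congr (_ * _ * _).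
  by apply: eq_big_nat => i /andP[ri _]; rewrite gtn_eqF.
have mom n : P.-integrable setT (EFin \o (fun w => Y w * xi r w ^+ n)).
  rewrite (_ : (fun w => _) = (fun w => S r w ^+ j * xi r w ^+ n * \1_(Ev r.+1 B) w)).
    apply: indic_int; first exact: mEv.
    by apply: all_moments_int; apply: all_momentsM; exact: all_momentsX.
  by apply/funext => w; rewrite /Y mulrAC.
have iX n : mu.-integrable setT (EFin \o (fun x => x ^+ n * normal_pdf 0 (sd r) x)).
  exact: (integrable_X_normal_pdf n s0).
have mX n : measurable_fun setT (fun x : R => x ^+ n) by exact: measurable_funX.
have dec := @decouple_ge0 _ _ _ P (xi r) _ (mxi r) (normal_pdf_ge0 0 (sd r))
  (integrable_normal_pdf 0 (sd r)) Y c iY HY.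
(* Decoupling is for nonnegative functions and x^k may be negative. Since g >= |x^k|, the power is
   the difference of the nonnegative functions g + x^k and g. *)
pose g (x : R) := 1 + x ^+ (k * 2).
have g0 x : 0 <= g x by rewrite addr_ge0// exprM sqr_ge0.
have gk0 x : 0 <= g x + x ^+ k.
  have : `|x ^+ k| <= g x.
    have := sqr_ge0 (`|x ^+ k| - 1); rewrite /g exprM.
    by rewrite sqrrB real_normK ?num_real// mulr2n; have := normr_ge0 (x ^+ k); lra.
  by rewrite ler_norml => /andP[+ _]; lra.
have mg : measurable_fun setT g by apply: measurable_funD.
have mgk : measurable_fun setT (fun x => g x + x ^+ k) by apply: measurable_funD.
have iYg : P.-integrable setT (EFin \o (fun w => Y w * g (xi r w))).
  rewrite (_ : (fun w => _) = (fun w => Y w + Y w * xi r w ^+ (k * 2))).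
    by apply: integrableD_EFin => //; exact: mom.
  by apply/funext => w; rewrite mulrDr mulr1.
have iYgk : P.-integrable setT (EFin \o (fun w => Y w * (g (xi r w) + xi r w ^+ k))).
  rewrite (_ : (fun w => _) = (fun w => Y w * g (xi r w) + Y w * xi r w ^+ k)).
    by apply: integrableD_EFin => //; exact: mom.
  by apply/funext => w; rewrite mulrDr.
have ig : mu.-integrable setT (EFin \o (fun x => g x * normal_pdf 0 (sd r) x)).
  rewrite (_ : (fun x => _) = (fun x => x ^+ 0 * normal_pdf 0 (sd r) x +
      x ^+ (k * 2) * normal_pdf 0 (sd r) x)).
    by apply: integrableD_EFin => //; exact: iX.
  by apply/funext => x; rewrite mulrDl expr0.
have igk : mu.-integrable setT (EFin \o (fun x => (g x + x ^+ k) * normal_pdf 0 (sd r) x)).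
  rewrite (_ : (fun x => _) = (fun x => g x * normal_pdf 0 (sd r) x +
      x ^+ k * normal_pdf 0 (sd r) x)).
    by apply: integrableD_EFin => //; exact: iX.
  by apply/funext => x; rewrite mulrDl.
have e1 := dec _ mg g0 iYg ig.
have e2 := dec _ mgk gk0 iYgk igk.
transitivity (\int[P]_w (Y w * (g (xi r w) + xi r w ^+ k) - Y w * g (xi r w))).
  by apply: eq_Rintegral => w _; rewrite mulrDr addrAC subrr add0r.
rewrite RintegralB// e1 e2 -mulrBr; congr (_ * _).
rewrite -RintegralB// -(normal_pdf_moment k s0).
by apply: eq_Rintegral => x _; rewrite mulrDl addrAC subrr add0r.
Qed.

(** Independence is given as a product formula for events, while moments are wanted. The increments
    are converted one at a time, so the statement carries the event on those of index at least [r];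
    at r = 0 it is the hypothesis, at r = N it is the moment formula. *)
Let main r : (r <= N)%N -> forall B m, (forall i, measurable (B i)) ->
  \int[P]_w (S r w ^+ m * \1_(Ev r B) w) =
  gaussm (\sum_(i < r) (a i * sd i) ^+ 2) m * \prod_(r <= i < N) nu i (B i).
Proof.
elim: r => [|r IH] rN B m mB.
  rewrite big_ord0.
  transitivity (0 ^+ m * \int[P]_w (\1_(Ev 0 B) w : R)).
    rewrite -RintegralZl//.
      by apply: eq_Rintegral => w _; rewrite /S big_ord0.
    by apply: integrable_indic => //; exact: mEv.
  rewrite /Rintegral integral_indic// ?setIT; last exact: mEv.
  congr (_ * _); last exact: (congr1 fine (lawE mB)).
  rewrite /gaussm expr0n; case: m => [|m]/=; first by rewrite /odd_dfact big_ord0 mulr1.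
  case: ifP => // om; rewrite expr0n; case: m om => //= m _.
  by rewrite mulr0.
have LS := S_moments (ltnW rN); have Lx := xi_moments rN.
have st := step rN (IH (ltnW rN)).
transitivity (\int[P]_w (\sum_(k < m.+1) ('C(m, k)%:R * a r ^+ k) *
    (S r w ^+ (m - k) * \1_(Ev r.+1 B) w * xi r w ^+ k))).
  apply: eq_Rintegral => w _.
  rewrite /S big_ord_recr/= exprDn mulr_suml; apply: eq_bigr => k _.
  rewrite -mulr_natl exprMn; ring.
have ik (k : 'I_m.+1) : P.-integrable setT (EFin \o (fun w =>
    S r w ^+ (m - k) * \1_(Ev r.+1 B) w * xi r w ^+ k)).
  rewrite (_ : (fun w => _) = (fun w => S r w ^+ (m - k) * xi r w ^+ k * \1_(Ev r.+1 B) w)).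
    apply: indic_int; first exact: mEv.
    by apply: all_moments_int; apply: all_momentsM; exact: all_momentsX.
  by apply/funext => w; rewrite mulrAC.
rewrite Rintegral_sum//; last by move=> k; apply: integrableZ_EFin.
have -> : \sum_(i < r.+1) (a i * sd i) ^+ 2 =
    a r ^+ 2 * sd r ^+ 2 + \sum_(i < r) (a i * sd i) ^+ 2.
  by rewrite big_ord_recr/= addrC exprMn.
rewrite -gaussmD mulr_suml; apply: eq_bigr => k _.
rewrite (RintegralZl _ measurableT (ik k)) st// gaussmZ; ring.
Qed.

Lemma increments_moments : all_moments P (fun w => \sum_(i < N) a i * xi i w).
Proof. exact: S_moments. Qed.

Lemma increments_momentE m :
  \int[P]_w (\sum_(i < N) a i * xi i w) ^+ m =
  gaussm (\sum_(i < N) (a i * sd i) ^+ 2) m.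
Proof.
have := @main N (leqnn N) (fun=> setT) m (fun=> measurableT).
rewrite big_geq// mulr1 => <-; apply: eq_Rintegral => w _.
by rewrite (_ : Ev _ _ = setT) ?indicT ?mulr1//; apply/seteqP; split.
Qed.

End IndependentIncrements.

(** * Riemann-Stieltjes sums *)

Section PathwiseIntegral.
Context {R : realType}.

Lemma cauchy_real_cvg (u : nat -> R) :
  (forall e, 0 < e -> exists N, forall m n, (N <= m)%N -> (N <= n)%N ->
    `|u m - u n| <= e) -> cvgn u.
Proof.
move=> uC; apply/cauchy_cvgP/cauchy_exP => e e0.
have e20 : 0 < e / 2 by rewrite divr_gt0.
have [N NP] := uC _ e20; exists (u N), N => // n /= Nn.
rewrite /ball/= (le_lt_trans (NP _ _ (leqnn _) Nn))//.
by rewrite ltr_pdivrMr// ltr_pMr// ltr1n.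
Qed.

(** Counterexamples at distance below 1/(n+1) would have, along a Bolzano-Weierstrass subsequence, a
    common limit point, where continuity is contradicted. *)
Lemma heine_cantor (x : R -> R) (a b : R) : continuous x ->
  forall e, 0 < e -> exists2 de, 0 < de & forall s t,
    a <= s <= b -> a <= t <= b -> `|s - t| < de -> `|x s - x t| <= e.
Proof.
move=> cx e e0; apply: contrapT => h.
have bad n : exists st : R * R, [/\ a <= st.1 <= b, a <= st.2 <= b,
    `|st.1 - st.2| < n.+1%:R^-1 & e < `|x st.1 - x st.2|].
  apply: contrapT => hn; apply: h; exists n.+1%:R^-1; first by rewrite invr_gt0.
  move=> s t sab tab st; rewrite leNgt; apply/negP => ex.
  by apply: hn; exists (s, t).
have [st stP] := choice bad.
have [f incf /cvg_ex[l sl]] : exists2 f : nat -> nat, increasing_seq f &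
    cvgn ((fun n => (st n).1) \o f).
  apply: bolzano_weierstrass; exists (`|a| + `|b|); split; first exact: num_real.
  move=> M abM n _ /=; apply: ltW; apply: le_lt_trans abM.
  have [/andP[sa sb] _ _ _] := stP n.
  rewrite ler_norml; apply/andP; split.
    apply: le_trans sa; rewrite lerNl.
    by rewrite -normrN (le_trans (ler_norm (- a)))// lerDl.
  by apply: (le_trans sb); rewrite (le_trans (ler_norm b))// lerDr.
have fn n : (n <= f n)%N.
  elim: n => // n IH; apply: (leq_ltn_trans IH).
  by have /increasing_seqP := incf; exact.
have tl : (st (f n)).2 @[n --> \oo] --> l.
  have -> : (fun n => (st (f n)).2) =
      (fun n => (st (f n)).1 - ((st (f n)).1 - (st (f n)).2)).
    by apply/funext => n; rewrite subKr.
  rewrite -[l]subr0; apply: cvgB; first exact: sl.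
  apply/norm_cvg0P; apply: (@squeeze_cvgr _ _ _ _ (cst 0) (fun n => n.+1%:R^-1 : R)).
  - apply: nearW => n; rewrite normr_ge0/=; have [_ _ h1 _] := stP (f n).
    apply: (le_trans (ltW h1)); rewrite lef_pV2 ?posrE// ler_nat ltnS; exact: fn.
  - exact: cvg_cst.
  - exact: cvg_harmonic.
have : `|x (st (f n)).1 - x (st (f n)).2| @[n --> \oo] --> `|x l - x l|.
  apply: cvg_norm; apply: cvgB.
    exact: (cvg_comp _ _ sl (cx l)).
  exact: (cvg_comp _ _ tl (cx l)).
rewrite subrr normr0 => /cvgrPdist_lt/(_ _ e0)[n _ /(_ n (leqnn n))].
rewrite /= sub0r normrN normr_id; have [_ _ _ h1] := stP (f n).
by rewrite ltNge (ltW h1).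
Qed.

Lemma sum_ord_mul (f : nat -> R) N M :
  \sum_(k < N * M) f k = \sum_(i < N) \sum_(j < M) f (i * M + j)%N.
Proof.
elim: N => [|N IH]; first by rewrite mul0n !big_ord0.
rewrite big_ord_recr/= -IH mulSnr big_split_ord/=; congr (_ + _).
Qed.

(** Summation by parts. A continuous path may have infinite variation, so the differences are moved
    to the Lipschitz integrand. *)
Lemma abel_sum (p y : nat -> R) M :
  \sum_(j < M) (p j - p 0%N) * (y j.+1 - y j) =
  \sum_(j < M) (y M - y j.+1) * (p j.+1 - p j).
Proof.
elim: M => [|M IH]; first by rewrite !big_ord0.
rewrite big_ord_recr/= IH [RHS]big_ord_recr/= subrr mul0r addr0.
have -> : p M - p 0%N = \sum_(j < M) (p j.+1 - p j).
  by rewrite -(big_mkord xpredT (fun j => p j.+1 - p j)) telescope_sumr.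
rewrite mulr_suml -big_split/=; apply: eq_bigr => j _; ring.
Qed.

Variables (T : R).
Hypothesis T0 : 0 < T.

(** Inside a coarse cell, summation by parts leaves differences of [x] of size at most e against
    increments of [phi] of size at most L T / (N M); the N M fine steps add up to e L T. *)
Lemma RS_sum_refine (phi x : R -> R) (L e : R) N M : (0 < N)%N -> (0 < M)%N ->
  0 <= L -> (forall s t, `|phi s - phi t| <= L * `|s - t|) ->
  (forall s t, 0 <= s <= T -> 0 <= t <= T -> `|s - t| <= T / N%:R -> `|x s - x t| <= e) ->
  `|RS_sum T phi x (N * M) - RS_sum T phi x N| <= e * L * T.
Proof.
move=> N0 M0 L0 phiL xe.
have N0' : 0 < N%:R :> R by rewrite ltr0n.
have M0' : 0 < M%:R :> R by rewrite ltr0n.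
have NM0 : 0 < N%:R * M%:R :> R by rewrite mulr_gt0.
pose u k : R := k%:R * T / (N * M)%:R.
have uE i : u (i * M)%N = i%:R * T / N%:R.
  by rewrite /u !natrM; field; rewrite !gt_eqF.
have -> : RS_sum T phi x N = \sum_(i < N) \sum_(j < M)
    phi (u (i * M)%N) * (x (u (i * M + j).+1) - x (u (i * M + j)%N)).
  apply: eq_bigr => i _; rewrite -mulr_sumr uE; congr (_ * _).
  rewrite -(big_mkord xpredT (fun j => x (u (i * M + j).+1) - x (u (i * M + j)%N))).
  under eq_bigr do rewrite -addnS.
  rewrite (telescope_sumr (fun j => x (u (i * M + j)%N)))//.
  by rewrite addn0 uE -mulSnr uE.
have -> : RS_sum T phi x (N * M) = \sum_(i < N) \sum_(j < M)
    phi (u (i * M + j)%N) * (x (u (i * M + j).+1) - x (u (i * M + j)%N)).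
  exact: (sum_ord_mul (fun k => phi (u k) * (x (u k.+1) - x (u k)))).
rewrite -sumrB.
apply: (le_trans (ler_norm_sum _ _ _)).
apply: (@le_trans _ _ (\sum_(i < N) \sum_(j < M) e * (L * (T / (N * M)%:R)))).
  apply: ler_sum => i _; rewrite -sumrB.
  have -> : \sum_(j < M) (phi (u (i * M + j)%N) *
      (x (u (i * M + j).+1) - x (u (i * M + j)%N)) -
      phi (u (i * M)%N) * (x (u (i * M + j).+1) - x (u (i * M + j)%N))) =
    \sum_(j < M) (phi (u (i * M + j)%N) - phi (u (i * M + 0)%N)) *
      (x (u (i * M + j.+1)%N) - x (u (i * M + j)%N)).
    by apply: eq_bigr => j _; rewrite addn0 -mulrBl addnS.
  rewrite (abel_sum (fun j => phi (u (i * M + j)%N)) (fun j => x (u (i * M + j)%N))).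
  apply: (le_trans (ler_norm_sum _ _ _)); apply: ler_sum => j _.
  have u01 k : (k <= N * M)%N -> 0 <= u k <= T.
    move=> kNM; apply/andP; split; first by rewrite divr_ge0 ?mulr_ge0// ltW.
    rewrite /u ler_pdivrMr ?natrM//; rewrite mulrC ler_wpM2l ?(ltW T0)//.
    by rewrite -natrM ler_nat.
  have iNM k : (k <= M)%N -> (i * M + k <= N * M)%N.
    by move=> kM; have := ltn_ord i; nia.
  have duE k l : (l <= k)%N -> `|u k - u l| = (k - l)%:R * (T / (N * M)%:R).
    move=> lk; rewrite /u -!mulrA -mulrBl -natrB// ger0_norm//.
    by rewrite mulr_ge0// divr_ge0// ltW.
  rewrite normrM; apply: ler_pM => //.
    apply: xe; [exact/u01/iNM|exact/u01/iNM|].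
    rewrite duE; last by rewrite leq_add2l.
    rewrite natrM mulrA ler_pdivrMr//.
    have -> : T / N%:R * (N%:R * M%:R) = M%:R * T by field; rewrite gt_eqF.
    by rewrite ler_wpM2r ?(ltW T0)// ler_nat; lia.
  apply: (le_trans (phiL _ _)); rewrite ler_wpM2l// duE; last by rewrite addnS.
  by rewrite addnS subSnn mul1r.
rewrite !sumr_const !card_ord -[_ *+ M]mulr_natr -[_ *+ N]mulr_natr natrM.
by rewrite le_eqVlt; apply/orP; left; apply/eqP; field; rewrite !gt_eqF.
Qed.

(** Uniform partitions are not nested, so the sums for m and n are both compared with the one for m
    n. *)
Lemma RS_sum_cvg (phi x : R -> R) (L : R) : 0 <= L ->
  (forall s t, `|phi s - phi t| <= L * `|s - t|) -> continuous x ->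
  cvgn (RS_sum T phi x).
Proof.
move=> L0 phiL cx; apply: cauchy_real_cvg => e e0.
(* Two comparisons cost 2 e' L T, which is at most e; the summand 1 avoids a division by 0 when L =
   0. *)
pose e' := e / (2 * (L * T + 1)).
have LT : 0 < L * T + 1 by rewrite ltr_wpDl// mulr_ge0// ltW.
have e'0 : 0 < e' by rewrite divr_gt0// mulr_gt0.
have [de de0 deP] := @heine_cantor x 0 T cx e' e'0.
pose N := (Num.truncn (T / de)).+1.
have key m n : (N <= m)%N -> (0 < n)%N ->
    `|RS_sum T phi x (m * n) - RS_sum T phi x m| <= e' * L * T.
  move=> Nm n0; have m0 : (0 < m)%N by exact: leq_ltn_trans Nm.
  apply: RS_sum_refine => // s t s01 t01 st; apply: deP => //.
  apply: (le_lt_trans st); rewrite ltr_pdivrMr ?ltr0n// mulrC -ltr_pdivrMr//.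
  by apply: (lt_le_trans (truncnS_gt _)); rewrite ler_nat.
exists N => m n Nm Nn.
have m0 : (0 < m)%N by exact: leq_ltn_trans Nm.
have n0 : (0 < n)%N by exact: leq_ltn_trans Nn.
have h1 := key m n Nm n0; have h2 := key n m Nn m0.
rewrite -(subrK (RS_sum T phi x (m * n)) (RS_sum T phi x m)) -addrA.
apply: (le_trans (ler_normD _ _)); rewrite distrC.
apply: (@le_trans _ _ (e' * L * T + e' * L * T)).
  by apply: lerD => //; rewrite mulnC.
have -> : e' * L * T + e' * L * T = e * (L * T) / (L * T + 1).
  by rewrite /e'; field; rewrite gt_eqF.
rewrite ler_pdivrMr// ler_wpM2l ?(ltW e0)//.
by rewrite lerDl.
Qed.

Lemma RS_sumDx (phi x y : R -> R) (c : R) N :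
  RS_sum T phi (fun t => y t + c * x t) N = RS_sum T phi y N + c * RS_sum T phi x N.
Proof. by rewrite /RS_sum mulr_sumr -big_split/=; apply: eq_bigr => i _; ring. Qed.

Lemma RS_sum_sum (I : Type) (s : seq I) (b : I -> R) (phi : I -> R -> R) x N :
  RS_sum T (fun t => \sum_(i <- s) b i * phi i t) x N =
  \sum_(i <- s) b i * RS_sum T (phi i) x N.
Proof.
rewrite /RS_sum; under eq_bigr do rewrite mulr_suml.
rewrite exchange_big/=; apply: eq_bigr => i _; rewrite mulr_sumr.
by apply: eq_bigr => k _; rewrite mulrA.
Qed.

End PathwiseIntegral.

(** * The cosine basis *)

Section LipschitzBounded.
Context {R : realType}.

(** Boundedness is included because products of Lipschitz functions are Lipschitz only with it. *)
Definition lipb (f : R -> R) := exists2 K, 0 <= K &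
  (forall s t, `|f s - f t| <= K * `|s - t|) /\ forall t, `|f t| <= K.

Lemma lipb_cst c : lipb (fun=> c).
Proof.
exists `|c| => //; split => // s t.
by rewrite subrr normr0 mulr_ge0.
Qed.

Lemma lipbD f g : lipb f -> lipb g -> lipb (fun t => f t + g t).
Proof.
move=> [K K0 [f1 f2]] [M M0 [g1 g2]]; exists (K + M); first exact: addr_ge0.
split=> [s t|t]; last by rewrite (le_trans (ler_normD _ _))// lerD.
by rewrite opprD addrACA (le_trans (ler_normD _ _))// mulrDl lerD.
Qed.

Lemma lipbM f g : lipb f -> lipb g -> lipb (fun t => f t * g t).
Proof.
move=> [K K0 [f1 f2]] [M M0 [g1 g2]]; exists (2 * K * M).
  by rewrite !mulr_ge0.
split=> [s t|t]; last first.
  rewrite normrM (@le_trans _ _ (K * M))//; first by rewrite ler_pM.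
  by rewrite -mulrA ler_peMl ?ler1n// mulr_ge0.
have -> : f s * g s - f t * g t = (f s - f t) * g s + f t * (g s - g t) by ring.
rewrite (le_trans (ler_normD _ _))// !normrM.
have -> : 2 * K * M * `|s - t| = K * `|s - t| * M + K * (M * `|s - t|) by ring.
by rewrite lerD// ler_pM.
Qed.

Lemma lipb_sum (I : Type) (r : seq I) (F : I -> R -> R) :
  (forall i, lipb (F i)) -> lipb (fun t => \sum_(i <- r) F i t).
Proof.
move=> FL; elim: r => [|i r IH].
  rewrite (_ : (fun t => _) = (fun=> 0)); first exact: lipb_cst.
  by apply/funext => t; rewrite big_nil.
rewrite (_ : (fun t => _) = (fun t => F i t + \sum_(j <- r) F j t)).
  exact: lipbD.
by apply/funext => t; rewrite big_cons.
Qed.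

Lemma lipschitz_is_derive (f df : R -> R) K :
  (forall x : R, is_derive x 1 f (df x)) -> (forall x, `|df x| <= K) ->
  forall s t, `|f s - f t| <= K * `|s - t|.
Proof.
move=> dfE dfK s t; have cf := is_derive_continuous dfE.
wlog st : s t / t <= s => [h|].
  have [|ts] := leP t s; first exact: h.
  by rewrite distrC (distrC s); apply: h; exact: ltW.
have wcf : {within `[t, s], continuous f} by exact: continuous_subspaceT.
have [c _ ->] := MVT_segment st (fun x _ => dfE x) wcf.
by rewrite normrM ler_wpM2r.
Qed.

Lemma is_derive_sum_fun n (h dh : 'I_n -> R -> R) (x : R) :
  (forall i, is_derive x 1 (h i) (dh i x)) ->
  is_derive x 1 (fun y => \sum_(i < n) h i y) (\sum_(i < n) dh i x).
Proof.
elim: n h dh => [|n IH] h dh hd.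
  rewrite big_ord0 (_ : (fun y => _) = cst 0); first exact: is_derive_cst.
  by apply/funext => y; rewrite big_ord0.
rewrite big_ord_recr/= (_ : (fun y => _) = (fun y => \sum_(i < n)
  h (widen_ord (leqnSn n) i) y) + h ord_max).
  by apply: is_deriveD => //; apply: (IH _ (fun i => dh (widen_ord (leqnSn n) i))).
by apply/funext => y; rewrite big_ord_recr.
Qed.

Lemma is_deriveZ_fun (f : R -> R) (k df x : R) : is_derive x 1 f df ->
  is_derive x 1 (fun y => k * f y) (k * df).
Proof. by move=> h; exact: (@is_deriveZ _ _ _ f k x 1 df h). Qed.

(** By the mean value theorem each increment of [F] is a value of [f] in the same cell, off by at
    most K T / N from the value at the left end. *)
Lemma riemann_sum_cvg (T : R) (F f : R -> R) : 0 < T ->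
  (forall x : R, is_derive x 1 F (f x)) -> lipb f ->
  \sum_(i < N) f (i%:R * T / N%:R) * (T / N%:R) @[N --> \oo] --> F T - F 0.
Proof.
move=> T0 dF [K K0 [fK _]]; have cF := is_derive_continuous dF.
apply/cvgrPdist_le => e e0.
exists (Num.truncn (K * T ^+ 2 / e)).+1 => // N /= NN.
have N0 : (0 < N)%N by exact: leq_ltn_trans NN.
have N0' : 0 < N%:R :> R by rewrite ltr0n.
pose u k : R := k%:R * T / N%:R.
have du k : u k.+1 - u k = T / N%:R by rewrite /u -mulrBl -mulrBl -natrB// subSnn mul1r.
have TN0 : 0 < T / N%:R by rewrite divr_gt0.
have -> : F T - F 0 = \sum_(i < N) (F (u i.+1) - F (u i)).
  rewrite -(big_mkord xpredT (fun i => F (u i.+1) - F (u i))).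
  rewrite (telescope_sumr (fun i => F (u i)))// /u !mul0r.
  by rewrite mulrC mulKf// gt_eqF.
rewrite -sumrB (le_trans (ler_norm_sum _ _ _))//.
apply: (@le_trans _ _ (\sum_(i < N) K * (T / N%:R) * (T / N%:R))).
  apply: ler_sum => i _.
  have ui : u i <= u i.+1 by rewrite -subr_ge0 du ltW.
  have wcF : {within `[u i, u i.+1], continuous F} by exact: continuous_subspaceT.
  have [c cu ->] := MVT_segment ui (fun x _ => dF x) wcF.
  rewrite du -mulrBl normrM (ger0_norm (ltW TN0)) ler_wpM2r ?(ltW TN0)//.
  rewrite (le_trans (fK _ _))// ler_wpM2l//.
  move: cu; rewrite in_itv/= => /andP[c1 c2].
  by rewrite ger0_norm ?subr_ge0// -(du i) lerB.
rewrite sumr_const card_ord -[_ *+ N]mulr_natr.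
have -> : K * (T / N%:R) * (T / N%:R) * N%:R = K * T ^+ 2 / N%:R.
  by field; rewrite gt_eqF.
rewrite ler_pdivrMr// -ler_pdivrMl// mulrC.
by apply: ltW; apply: (lt_le_trans (truncnS_gt _)); rewrite ler_nat.
Qed.

End LipschitzBounded.

Section CosineBasis.
Context {R : realType} (T : R).
Hypothesis T0 : 0 < T.
Notation mu := (@lebesgue_measure R).

Definition cosk (k : nat) (t : R) : R := cos (k%:R * pi * t / T).

Definition cos_norm (k : nat) : R :=
  if k == 0%N then (Num.sqrt T)^-1 else Num.sqrt (2 / T).

Lemma cons_basisE k t : cons_basis T k t = cos_norm k * cosk k t.
Proof.
rewrite /cons_basis /cos_norm /cosk; case: eqP => [->|//].
by rewrite !mul0r cos0 mulr1.
Qed.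

Let lin k : R := k%:R * pi / T.

Let coskE k : cosk k = cos \o (fun t => lin k * t).
Proof. by apply/funext => t; rewrite /cosk /lin /= mulrAC. Qed.

Let is_derive_lin k (t : R) : is_derive t 1 (fun t => lin k * t) (lin k).
Proof.
have := @is_deriveZ_fun _ (@idfun R) (lin k) 1 t (is_derive_id t 1).
by rewrite mulr1.
Qed.

Lemma is_derive_cosk k (t : R) :
  is_derive t 1 (cosk k) (- (lin k * sin (lin k * t))).
Proof.
rewrite coskE.
have := @is_derive1_comp _ cos _ t _ _ (is_derive_cos _) (is_derive_lin k t).
by move=> h; apply: (is_derive_eq h); rewrite mulNr mulrC.
Qed.

Lemma lipb_cosk k : lipb (cosk k).
Proof.
exists (`|lin k| + 1); first by rewrite addr_ge0.
split=> [|t]; last first.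
  by apply: (@le_trans _ _ 1); rewrite ?lerDr// ler_norml cos_geN1 cos_le1.
move=> s t; apply: (@le_trans _ _ (`|lin k| * `|s - t|)); last first.
  by rewrite ler_wpM2r// lerDl.
apply: (lipschitz_is_derive (is_derive_cosk k)) => x.
by rewrite normrN normrM ler_piMr// ler_norml sin_geN1 sin_le1.
Qed.

Lemma lipb_cons_basis k : lipb (cons_basis T k).
Proof.
rewrite (_ : cons_basis T k = (fun t => cos_norm k * cosk k t)).
  by apply: lipbM; [exact: lipb_cst|exact: lipb_cosk].
by apply/funext => t; rewrite cons_basisE.
Qed.

Let sin_natpi (k : nat) : sin (k%:R * pi) = 0 :> R.
Proof.
elim: k => [|k IH]; first by rewrite mul0r sin0.
by rewrite -natr1 mulrDl mul1r sinDpi IH oppr0.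
Qed.

Lemma cosk_primitive k : exists2 F : R -> R,
  (forall t : R, is_derive t 1 F (cosk k t)) & F T - F 0 = (k == 0%N)%:R * T.
Proof.
have [->|k0] := eqVneq k 0%N.
  exists idfun => [t|]; last by rewrite subr0 mul1r.
  by apply: is_derive_eq; rewrite /cosk !mul0r cos0.
have l0 : lin k != 0.
  by rewrite /lin !mulf_neq0// ?pnatr_eq0// ?invr_eq0 gt_eqF// pi_gt0.
exists (fun t => (lin k)^-1 * (sin \o (fun t => lin k * t)) t) => [t|].
  have h := @is_derive1_comp _ sin _ t _ _ (is_derive_sin _) (is_derive_lin k t).
  apply: (is_derive_eq (is_deriveZ_fun (lin k)^-1 h)).
  by rewrite coskE /= mulrCA mulVf// mulr1.
rewrite /=; have -> : lin k * T = k%:R * pi by rewrite /lin divfK// gt_eqF.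
by rewrite sin_natpi !mulr0 sin0 mulr0 subr0 mul0r.
Qed.

(** The sum of the two truncated differences is |k - l|. *)
Lemma coskM k l t : cosk k t * cosk l t =
  2^-1 * (cosk (k + l) t + cosk ((k - l) + (l - k)) t).
Proof.
have cc (a b : R) : cos a * cos b = 2^-1 * (cos (a + b) + cos (a - b)).
  by rewrite cosD cosB; field.
rewrite {1 2}/cosk cc; congr (_ * (_ + _)).
  by rewrite /cosk natrD; congr cos; ring.
have [kl|lk] := leqP k l.
  rewrite (eqP kl) add0n /cosk natrB//= -cosN; congr cos; ring.
rewrite [(l - k)%N](eqP (ltnW lk)) addn0 /cosk natrB ?(ltnW lk)//; congr cos; ring.
Qed.

Lemma cos_norm_sq k : cos_norm k ^+ 2 * ((k == 0%N)%:R + 1) * T = 2.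
Proof.
rewrite /cos_norm; case: eqP => _.
  rewrite exprVn sqr_sqrtr ?(ltW T0)// mulrAC mulVf ?gt_eqF// mul1r.
  by rewrite /= mulr1n -mulr2n.
by rewrite sqr_sqrtr ?divr_ge0 ?(ltW T0)// add0r mulr1 divfK// gt_eqF.
Qed.

(** Orthonormality is phrased with a primitive because it serves twice: for limits of Riemann sums,
    where variances are computed, and for Lebesgue integrals in Parseval's identity. *)
Lemma cons_basis_primitive k l : exists2 F : R -> R,
  (forall t : R, is_derive t 1 F (cons_basis T k t * cons_basis T l t)) &
  F T - F 0 = (k == l)%:R.
Proof.
have [F dF F0] := cosk_primitive (k + l).
have [G dG G0] := cosk_primitive ((k - l) + (l - k)).
pose a := cos_norm k * cos_norm l * 2^-1.
exists (fun t => a * (F t + G t)) => [t|].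
  have h := is_deriveD (dF t) (dG t).
  apply: (is_derive_eq (is_deriveZ_fun a h)).
  by rewrite !cons_basisE mulrACA coskM /a !mulrA.
rewrite -mulrBr opprD addrACA F0 G0.
have [kl|kl] := eqVneq k l.
  subst l; rewrite subnn addn0 eqxx addnn double_eq0 mul1r /a -expr2.
  have := cos_norm_sq k; rewrite mulrDr mulr1 mulrDl => e.
  by rewrite mulrAC mulrDr mulrA e mulfV.
have -> : (k + l == 0)%N = false by apply/negbTE; move: kl; lia.
have -> : ((k - l) + (l - k) == 0)%N = false by apply/negbTE; move: kl; lia.
by rewrite !mul0r addr0 mulr0.
Qed.

Definition cos_poly N (b : nat -> R) t := \sum_(k < N) b k * cons_basis T k t.

Lemma lipb_cos_poly N b : lipb (cos_poly N b).
Proof.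
apply: lipb_sum => k; apply: lipbM; [exact: lipb_cst|exact: lipb_cons_basis].
Qed.

Lemma cos_poly_primitive N b : exists2 F : R -> R,
  (forall t : R, is_derive t 1 F (cos_poly N b t ^+ 2)) &
  F T - F 0 = \sum_(k < N) b k ^+ 2.
Proof.
have hF k : exists G : nat -> R -> R, forall l, (forall t : R,
    is_derive t 1 (G l) (cons_basis T k t * cons_basis T l t)) /\
    G l T - G l 0 = (k == l)%:R.
  have h l : exists F : R -> R, (forall t : R,
    is_derive t 1 F (cons_basis T k t * cons_basis T l t)) /\
    F T - F 0 = (k == l)%:R.
    by have [F ? ?] := cons_basis_primitive k l; exists F.
  by have [G GP] := choice h; exists G.
have [F FP] := choice hF.
exists (fun t => \sum_(k < N) \sum_(l < N) b k * b l * F k l t) => [t|].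
  have h (k : 'I_N) : is_derive t 1 (fun t => \sum_(l < N) b k * b l * F k l t)
      ((fun t => \sum_(l < N) b k * b l * (cons_basis T k t * cons_basis T l t)) t).
    apply: (@is_derive_sum_fun _ _ (fun l t => b k * b l * F k l t)
      (fun l t => b k * b l * (cons_basis T k t * cons_basis T l t))) => l.
    by apply: is_deriveZ_fun; have [] := FP k l.
  apply: (is_derive_eq (@is_derive_sum_fun _ N _ (fun (k : 'I_N) t =>
    \sum_(l < N) b k * b l * (cons_basis T k t * cons_basis T l t)) t h)).
  rewrite /cos_poly expr2 mulr_suml; apply: eq_bigr => k _.
  rewrite mulr_sumr; apply: eq_bigr => l _; ring.
rewrite -sumrB; apply: eq_bigr => k _; rewrite -sumrB (bigD1 k)//=.
rewrite big1; last first.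
  move=> l lk; rewrite -mulrBr; have [_ ->] := FP k l.
  by rewrite eq_sym (_ : _ == _ = false) ?mulr0//; apply/negbTE.
by rewrite addr0 -mulrBr; have [_ ->] := FP k k; rewrite eqxx mulr1 expr2.
Qed.

Lemma continuous_lipb (f : R -> R) : lipb f -> continuous f.
Proof.
move=> [K K0 [fK _]] x; apply/cvgrPdist_lt => e e0.
near=> y; apply: (le_lt_trans (fK _ _)).
apply: (@le_lt_trans _ _ ((K + 1) * `|x - y|)); first by rewrite ler_wpM2r// lerDl.
rewrite mulrC -ltr_pdivlMr ?ltr_wpDl//.
near: y; have ek : 0 < e / (K + 1) by rewrite divr_gt0// ltr_wpDl.
exact: (nbhsx_ballx x _ ek).
Unshelve. all: by end_near. Qed.

(** The sums on the left are the variances of the Riemann-Stieltjes sums of [cos_poly] against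
    Brownian motion. *)
Lemma riemann_cos_poly N b :
  \sum_(i < M) cos_poly N b (i%:R * T / M%:R) ^+ 2 * (T / M%:R) @[M --> \oo] -->
  \sum_(k < N) b k ^+ 2.
Proof.
have [F dF <-] := cos_poly_primitive N b.
apply: (riemann_sum_cvg T0 dF).
by apply: lipbM; exact: lipb_cos_poly.
Qed.

End CosineBasis.

(** * Completeness of the cosine basis *)

Section Kuhn.
Context {R : realType}.

Lemma bernoulli_ineq (x : R) n : -1 <= x -> 1 + n%:R * x <= (1 + x) ^+ n.
Proof.
move=> x1; elim: n => [|n IH]; first by rewrite mul0r addr0 expr0.
have x0 : 0 <= 1 + x by rewrite addrC -[1]opprK subr_ge0.
rewrite exprS (le_trans _ (ler_wpM2l x0 IH))//.
have -> : (1 + x) * (1 + n%:R * x) = 1 + n.+1%:R * x + n%:R * x ^+ 2.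
  by rewrite -natr1; ring.
by rewrite lerDl mulr_ge0// sqr_ge0.
Qed.

(* Kuhn's polynomials: they converge boundedly to a step function on [0, 1]. *)
Definition kuhn n (y : R) := (1 - y ^+ n) ^+ (2 ^ n).

Lemma kuhn_ge0 n y : 0 <= y <= 1 -> 0 <= kuhn n y.
Proof. by move=> /andP[y0 y1]; rewrite exprn_ge0// subr_ge0 exprn_ile1. Qed.

Lemma kuhn_le1 n y : 0 <= y <= 1 -> kuhn n y <= 1.
Proof.
move=> /andP[y0 y1]; rewrite exprn_ile1 ?subr_ge0 ?exprn_ile1//.
by rewrite lerBlDr lerDl exprn_ge0.
Qed.

(** Bernoulli's inequality gives the lower bound 1 - 2^n y^n = 1 - (2y)^n. *)
Lemma kuhn_cvg1 y : 0 <= y < 2^-1 -> kuhn n y @[n --> \oo] --> (1 : R).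
Proof.
move=> /andP[y0 y2].
have y1 : y <= 1 by apply: ltW; apply: (lt_le_trans y2); rewrite invf_le1// ler1n.
have cl : 1 - (2 * y) ^+ n @[n --> \oo] --> (1 : R).
  rewrite -[X in _ --> X]subr0; apply: cvgB; first exact: cvg_cst.
  apply: cvg_expr; rewrite ger0_norm ?mulr_ge0//.
  by rewrite -ltr_pdivlMl// mulr1.
apply: (@squeeze_cvgr _ _ _ _ (fun n => 1 - (2 * y) ^+ n) (cst 1)) => //.
  apply: nearW => n; rewrite kuhn_le1 ?y0// andbT.
  apply: (le_trans _ (@bernoulli_ineq (- y ^+ n) (2 ^ n) _)).
    by rewrite mulrN exprMn natrX.
  by rewrite lerN2 exprn_ile1.
exact: cvg_cst.
Qed.

(** Multiplied by (1 + y^n)^(2^n), the polynomial becomes (1 - y^(2n))^(2^n) <= 1, and by Bernoulli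
    that factor is at least (2y)^n. *)
Lemma kuhn_cvg0 y : 2^-1 < y <= 1 -> kuhn n y @[n --> \oo] --> (0 : R).
Proof.
move=> /andP[y2 y1]; have y0 : 0 < y by apply: lt_trans y2.
have y2' : 1 < 2 * y by rewrite -ltr_pdivrMl// mulr1.
have y20 : 0 < 2 * y by rewrite mulr_gt0.
have cl : (2 * y)^-1 ^+ n @[n --> \oo] --> (0 : R).
  by apply: cvg_expr; rewrite ger0_norm ?invr_ge0 ?(ltW y20)// invf_lt1.
apply: (@squeeze_cvgr _ _ _ _ (cst 0) (fun n => (2 * y)^-1 ^+ n)) => //; last first.
  exact: cvg_cst.
apply: nearW => n; rewrite kuhn_ge0 ?(ltW y0)//=.
have yn0 : 0 < y ^+ n by rewrite exprn_gt0.
have h1 : kuhn n y * (1 + y ^+ n) ^+ (2 ^ n) <= 1.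
  rewrite -exprMn (_ : (1 - y ^+ n) * (1 + y ^+ n) = 1 - (y ^+ n) ^+ 2); last by ring.
  have yn1 : (y ^+ n) ^+ 2 <= 1 by rewrite -exprM exprn_ile1// ltW.
  by rewrite exprn_ile1// ?subr_ge0// lerBlDr lerDl sqr_ge0.
have h2 : (2 * y) ^+ n <= (1 + y ^+ n) ^+ (2 ^ n).
  apply: le_trans (@bernoulli_ineq (y ^+ n) (2 ^ n) _).
    by rewrite exprMn natrX lerDr.
  by rewrite (le_trans _ (ltW yn0))// lerN10.
rewrite exprVn -[leRHS]mul1r ler_pdivlMr ?exprn_gt0//.
apply: (le_trans _ h1); rewrite ler_wpM2l// kuhn_ge0//.
by rewrite (ltW y0).
Qed.

End Kuhn.

(** * Density of cosine polynomials in L_2[0,T] and Parseval's identity *)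

Section CosineDense.
Context {R : realType} (T : R).
Hypothesis T0 : 0 < T.
Notation mu := (@lebesgue_measure R).
Notation D := (`[0, T] : set R).
Implicit Types u v f g : R -> R.

Let mD : measurable (D : set (measurableTypeR R)). Proof. exact: measurable_itv. Qed.

Let muD : (mu D < +oo)%E.
Proof. by rewrite /= lebesgue_measure_itv/= lte_fin T0 -EFinB ltry. Qed.

Let icst (c : R) : mu.-integrable D (EFin \o cst c).
Proof.
apply: (@measurable_bounded_integrable _ _ _ mu (cst c) D mD muD) => //.
by exists `|c|; split => // M cM x _ /=; exact: ltW.
Qed.

Lemma inL2_int2 u v : inL2 T u -> inL2 T v ->
  mu.-integrable D (EFin \o (fun t => u t * v t)).
Proof.
move=> [mu1 iu] [mv iv].
apply: (@le_integrable _ _ _ mu _ mD _ (EFin \o (fun t => u t ^+ 2 + v t ^+ 2))).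
- by apply/measurable_EFinP; apply: measurable_funM.
- move=> t _; rewrite /= lee_fin (le_trans (le_normM_sqrD _ _))//.
  exact: ler_norm.
- exact: integrableD_EFin.
Qed.

Lemma inL2_bounded u K : measurable_fun D u -> (forall t, D t -> `|u t| <= K) ->
  inL2 T u.
Proof.
move=> mu1 uK; split => //.
apply: (@le_integrable _ _ _ mu _ mD _ (EFin \o cst (K ^+ 2))) => //.
- by apply/measurable_EFinP; apply: measurable_funX.
- move=> t Dt; rewrite /= lee_fin !normrX lerXn2r ?nnegrE//.
  by rewrite (le_trans (uK t Dt))// ler_norm.
Qed.

Lemma inL2D u v : inL2 T u -> inL2 T v -> inL2 T (fun t => u t + v t).
Proof.
move=> Lu Lv; have [mu1 iu] := Lu; have [mv iv] := Lv.
split; first exact: measurable_funD.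
have iuv := inL2_int2 Lu Lv.
have := integrableD_EFin mD (integrableD_EFin mD iu iv) (integrableZ_EFin mD 2 iuv).
congr (_.-integrable _ _); apply/funext => t /=; congr EFin; ring.
Qed.

Lemma inL2Z u c : inL2 T u -> inL2 T (fun t => c * u t).
Proof.
move=> [mu1 iu]; split; first exact: measurable_funM.
have := integrableZ_EFin mD (c ^+ 2) iu.
by congr (_.-integrable _ _); apply/funext => t /=; congr EFin; rewrite exprMn.
Qed.

Lemma inL2B u v : inL2 T u -> inL2 T v -> inL2 T (fun t => u t - v t).
Proof.
move=> Lu /(inL2Z (-1)) Lv; have := inL2D Lu Lv.
by congr inL2; apply/funext => t; rewrite mulN1r.
Qed.

Lemma inL2_sum (I : Type) (r : seq I) (F : I -> R -> R) :
  (forall i, inL2 T (F i)) -> inL2 T (fun t => \sum_(i <- r) F i t).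
Proof.
move=> FL; elim: r => [|i r IH].
  rewrite (_ : (fun t => _) = cst 0).
    by apply: (@inL2_bounded _ 0) => // t _; rewrite normr0.
  by apply/funext => t; rewrite big_nil.
rewrite (_ : (fun t => _) = (fun t => F i t + \sum_(j <- r) F j t)).
  exact: inL2D.
by apply/funext => t; rewrite big_cons.
Qed.

Lemma inL2_lipb u : lipb u -> inL2 T u.
Proof.
move=> Lu; have [K K0 [_ uK]] := Lu; apply: (@inL2_bounded _ K) => //.
by apply: measurable_funTS; apply: continuous_measurable_fun; exact: continuous_lipb.
Qed.

Lemma inL2_indic (A : set R) : measurable A -> inL2 T (\1_A : R -> R).
Proof.
move=> mA; apply: (@inL2_bounded _ 1) => //.
by move=> t _; rewrite indicE; case: (_ \in _); rewrite ?normr1 ?normr0.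
Qed.

(** A representation at every large length lets two polynomials share a length, and fits the shape
    of a limit in N for Parseval's identity. *)
Definition cpoly g := exists N0, forall N, (N0 <= N)%N ->
  exists b, forall t, g t = cos_poly T N b t.

Lemma cpolyD f g : cpoly f -> cpoly g -> cpoly (fun t => f t + g t).
Proof.
move=> [n fn] [m gm]; exists (maxn n m) => N; rewrite geq_max => /andP[nN mN].
have [b fb] := fn N nN; have [c gc] := gm N mN.
exists (fun k => b k + c k) => t; rewrite fb gc /cos_poly -big_split/=.
by apply: eq_bigr => k _; rewrite mulrDl.
Qed.

Lemma cpolyZ f a : cpoly f -> cpoly (fun t => a * f t).
Proof.
move=> [n fn]; exists n => N nN; have [b fb] := fn N nN.
exists (fun k => a * b k) => t; rewrite fb /cos_poly mulr_sumr.
by apply: eq_bigr => k _; rewrite mulrA.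
Qed.

Lemma cpoly_cosk k : cpoly (cosk T k).
Proof.
exists k.+1 => N kN; exists (fun j => if j == k then (cos_norm T k)^-1 else 0) => t.
rewrite /cos_poly (bigD1 (Ordinal kN))//= eqxx big1 ?addr0; last first.
  move=> j jk; rewrite (_ : (nat_of_ord j == k) = false) ?mul0r//.
  by apply/negbTE; move: jk; apply: contra => /eqP jk; apply/eqP/val_inj.
rewrite cons_basisE mulKf//.
have := cos_norm_sq T0 k; apply: contra_eq_neq => ->.
by rewrite expr0n !mul0r eq_sym pnatr_eq0.
Qed.

Lemma cpoly_sum (I : Type) (r : seq I) (F : I -> R -> R) :
  (forall i, cpoly (F i)) -> cpoly (fun t => \sum_(i <- r) F i t).
Proof.
move=> FL; elim: r => [|i r IH].
  exists 0%N => N _; exists (fun=> 0) => t.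
  by rewrite big_nil /cos_poly big1// => k _; rewrite mul0r.
have [N0 h] := cpolyD (FL i) IH; exists N0 => N /h[b bP]; exists b => t.
by rewrite big_cons -bP.
Qed.

Lemma eq_cpoly f g : f =1 g -> cpoly f -> cpoly g.
Proof. by move=> /funext ->. Qed.

(** The product-to-sum formula makes cosine polynomials an algebra, so Kuhn's polynomials may be
    composed with them. *)
Lemma cpolyM f g : cpoly f -> cpoly g -> cpoly (fun t => f t * g t).
Proof.
move=> [n /(_ n (leqnn n))[b fb]] [m /(_ m (leqnn m))[c gc]].
pose h (k l : nat) t := b k * c l * (cos_norm T k * cos_norm T l) *
  (2^-1 * (cosk T (k + l) t + cosk T ((k - l) + (l - k)) t)).
apply: (@eq_cpoly (fun t => \sum_(k < n) \sum_(l < m) h k l t)).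
  move=> t; rewrite fb gc /cos_poly mulr_suml; apply: eq_bigr => k _.
  rewrite mulr_sumr; apply: eq_bigr => l _.
  by rewrite /h -coskM !cons_basisE; ring.
apply: cpoly_sum => k; apply: cpoly_sum => l; apply: cpolyZ; apply: cpolyZ.
by apply: cpolyD; exact: cpoly_cosk.
Qed.

Lemma cpoly_cst a : cpoly (fun=> a).
Proof.
apply: (@eq_cpoly (fun t => a * cosk T 0 t)); last exact/cpolyZ/cpoly_cosk.
by move=> t; rewrite /cosk !mul0r cos0 mulr1.
Qed.

Lemma cpolyX f n : cpoly f -> cpoly (fun t => f t ^+ n).
Proof.
move=> fc; elim: n => [|n IH].
  by apply: eq_cpoly (cpoly_cst 1) => t; rewrite expr0.
by apply: eq_cpoly (cpolyM fc IH) => t; rewrite exprS.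
Qed.

Lemma cpoly_inL2 f : cpoly f -> inL2 T f.
Proof.
move=> [n /(_ n (leqnn n))[b /funext ->]]; apply: inL2_lipb.
exact: lipb_cos_poly.
Qed.

Definition dist2 u v := \int[mu]_(t in D) (u t - v t) ^+ 2.

Definition cos_approx u := forall e, 0 < e -> exists2 g, cpoly g & dist2 u g <= e.

(** [dist2] is the square of the distance, whence the factor 2 here and the tolerances e / 4
    below. *)
Lemma dist2_triangle u v w : inL2 T u -> inL2 T v -> inL2 T w ->
  dist2 u w <= 2 * dist2 u v + 2 * dist2 v w.
Proof.
move=> Lu Lv Lw.
have [_ i1] := inL2B Lu Lw; have [_ i2] := inL2B Lu Lv; have [_ i3] := inL2B Lv Lw.
have j2 := integrableZ_EFin mD 2 i2; have j3 := integrableZ_EFin mD 2 i3.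
rewrite /dist2 -!RintegralZl// -RintegralD//; apply: le_Rintegral => //.
  exact: integrableD_EFin.
move=> t _; rewrite -subr_ge0 (_ : _ - _ = (u t - v t - (v t - w t)) ^+ 2) ?sqr_ge0//.
by ring.
Qed.

Lemma cos_approx_limit u : inL2 T u ->
  (forall e, 0 < e -> exists v, [/\ inL2 T v, cos_approx v & dist2 u v <= e]) ->
  cos_approx u.
Proof.
move=> Lu h e e0; have e40 : 0 < e / 4 by rewrite divr_gt0.
have [v [Lv av uv]] := h _ e40; have [g cg vg] := av _ e40; exists g => //.
rewrite (le_trans (dist2_triangle Lu Lv (cpoly_inL2 cg)))//.
by move: uv vg; lra.
Qed.

Lemma cos_approx_seq u (v : nat -> R -> R) h : inL2 T u ->
  (forall n, inL2 T (v n)) -> (forall n, cos_approx (v n)) ->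
  {ae mu, forall t, D t -> v n t @[n --> \oo] --> u t} ->
  mu.-integrable D (EFin \o h) ->
  (forall n t, D t -> (u t - v n t) ^+ 2 <= h t) ->
  cos_approx u.
Proof.
move=> Lu Lv av vu ih uvh; apply: cos_approx_limit => // e e0.
have [mu1 _] := Lu; have mv n : measurable_fun D (v n) by have [] := Lv n.
have /cvgrPdist_le/(_ _ e0)[n _ /(_ n (leqnn n))] :=
  Rdominated_cvg_sqr mD mv mu1 vu ih uvh.
rewrite /= sub0r normrN => hn; exists (v n); split => //.
exact: (le_trans (ler_norm _) hn).
Qed.

Lemma cos_approx_cpoly g : cpoly g -> cos_approx g.
Proof.
move=> cg e e0; exists g => //; rewrite /dist2.
under eq_Rintegral do rewrite subrr expr0n/=.
by rewrite Rintegral_cst// mul0r ltW.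
Qed.

Lemma cos_approxD u v : inL2 T u -> inL2 T v -> cos_approx u -> cos_approx v ->
  cos_approx (fun t => u t + v t).
Proof.
move=> Lu Lv au av e e0; have e40 : 0 < e / 4 by rewrite divr_gt0.
have [g cg ug] := au _ e40; have [h ch vh] := av _ e40.
exists (fun t => g t + h t); first exact: cpolyD.
have Lg := cpoly_inL2 cg; have Lh := cpoly_inL2 ch.
have [_ i1] := inL2B (inL2D Lu Lv) (inL2D Lg Lh).
have [_ i2] := inL2B Lu Lg; have [_ i3] := inL2B Lv Lh.
have j2 := integrableZ_EFin mD 2 i2; have j3 := integrableZ_EFin mD 2 i3.
apply: (@le_trans _ _ (2 * dist2 u g + 2 * dist2 v h)); last by move: ug vh; lra.
rewrite /dist2 -!RintegralZl// -RintegralD//; apply: le_Rintegral => //.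
  exact: integrableD_EFin.
move=> t _; rewrite -subr_ge0 (_ : _ - _ = (u t - g t - (v t - h t)) ^+ 2) ?sqr_ge0//.
by ring.
Qed.

Lemma cos_approxZ u c : inL2 T u -> cos_approx u -> cos_approx (fun t => c * u t).
Proof.
move=> Lu au e e0; have c0 : 0 < c ^+ 2 + 1 by rewrite ltr_wpDl// sqr_ge0.
have [|g cg ug] := au (e / (c ^+ 2 + 1)); first by rewrite divr_gt0.
exists (fun t => c * g t); first exact: cpolyZ.
have [_ i1] := inL2B Lu (cpoly_inL2 cg).
rewrite /dist2 (_ : \int[mu]_(t in D) _ = c ^+ 2 * dist2 u g); last first.
  rewrite /dist2 -RintegralZl//; apply: eq_Rintegral => t _.
  by rewrite -mulrBr exprMn.
apply: (@le_trans _ _ (c ^+ 2 * (e / (c ^+ 2 + 1)))).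
  by rewrite ler_wpM2l// sqr_ge0.
rewrite mulrA ler_pdivrMr// mulrC ler_wpM2l ?(ltW e0)//.
by rewrite lerDl.
Qed.

Lemma cos_approx_sum (I : Type) (r : seq I) (F : I -> R -> R) :
  (forall i, inL2 T (F i)) -> (forall i, cos_approx (F i)) ->
  cos_approx (fun t => \sum_(i <- r) F i t).
Proof.
move=> LF aF; elim: r => [|i r IH].
  rewrite (_ : (fun t => _) = (fun=> 0)); first exact/cos_approx_cpoly/cpoly_cst.
  by apply/funext => t; rewrite big_nil.
rewrite (_ : (fun t => _) = (fun t => F i t + \sum_(j <- r) F j t)).
  by apply: cos_approxD => //; exact: inL2_sum.
by apply/funext => t; rewrite big_cons.
Qed.

Lemma sqrB_le1 (a b : R) : 0 <= a <= 1 -> 0 <= b <= 1 -> (a - b) ^+ 2 <= 1.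
Proof. by move=> /andP[a0 a1] /andP[b0 b1]; nra. Qed.

Lemma cos_approx_ray s : cos_approx (\1_(`]-oo, s[%classic) : R -> R).
Proof.
have Ls : inL2 T (\1_(`]-oo, s[%classic) : R -> R) by apply: inL2_indic.
have outside c : (forall t, D t -> \1_(`]-oo, s[%classic) t = c :> R) ->
    cos_approx (\1_(`]-oo, s[%classic) : R -> R).
  move=> h e e0; exists (fun=> c); first exact: cpoly_cst.
  rewrite /dist2 (_ : \int[mu]_(t in D) _ = \int[mu]_(t in D) (cst 0 t)); last first.
    by apply: eq_Rintegral => t /set_mem Dt; rewrite h// subrr expr0n.
  by rewrite Rintegral_cst// mul0r ltW.
have [s0|s0] := leP s 0.
  apply: (outside 0) => t; rewrite /= in_itv/= => /andP[t0 _].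
  rewrite indicE memNset//= in_itv/=; apply/negP.
  by rewrite -leNgt (le_trans s0).
have [sT|Ts] := leP s T; last first.
  apply: (outside 1) => t; rewrite /= in_itv/= => /andP[_ tT].
  by rewrite indicE mem_set//= in_itv/= (le_lt_trans tT).
(* Dividing by 4 keeps [y] in [0, 1]. Since the cosine decreases on [0, pi], y is below 1/2 for t <
   s and above it for t > s, so Kuhn's polynomials in [y] tend to the indicator except at the null
   point s. *)
pose y t : R := 2^-1 + (cosk T 1 s - cosk T 1 t) / 4.
have cosB t : -1 <= cosk T 1 t <= 1 by rewrite cos_geN1 cos_le1.
have y01 t : 0 <= y t <= 1.
  by rewrite /y; have /andP[] := cosB t; have /andP[] := cosB s; lra.
have cy : cpoly y.
  apply: (@eq_cpoly (fun t => (2^-1 + cosk T 1 s / 4) + (- 4^-1) * cosk T 1 t)).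
    by move=> t; rewrite /y; ring.
  by apply: cpolyD; [exact: cpoly_cst|exact/cpolyZ/cpoly_cosk].
have ck n : cpoly (fun t => kuhn n (y t)).
  apply: cpolyX; apply: (@eq_cpoly (fun t => 1 + (-1) * y t ^+ n)).
    by move=> t; rewrite mulN1r.
  by apply: cpolyD; [exact: cpoly_cst|exact/cpolyZ/cpolyX].
have angle t : D t -> 1%:R * pi * t / T \in `[0, pi]%R.
  rewrite /= !in_itv/= mul1r => /andP[t0 tT].
  rewrite divr_ge0 ?mulr_ge0 ?pi_ge0 ?(ltW T0)//=.
  by rewrite ler_pdivrMr// ler_wpM2l// pi_ge0.
have cosk_mono t t' : D t -> D t' -> t < t' -> cosk T 1 t' < cosk T 1 t.
  move=> Dt Dt' tt'; rewrite /cosk ltr_cos ?angle//.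
  by rewrite ltr_pM2r ?invr_gt0// ltr_pM2l// mul1r pi_gt0.
have Ds : D s by rewrite /= in_itv/= (ltW s0).
apply: (@cos_approx_seq _ (fun n t => kuhn n (y t)) (cst 1)) => //.
- by move=> n; exact: cpoly_inL2.
- by move=> n; exact: cos_approx_cpoly.
- exists [set s]; split; first exact: measurable_set1.
    exact: lebesgue_measure_set1.
  move=> t /= h; apply: contrapT => ts; apply: h => Dt.
  have [st|st] := ltP t s.
    rewrite indicE mem_set/=; last by rewrite in_itv.
    apply: kuhn_cvg1; have /andP[-> _] := y01 t.
    by have := cosk_mono _ _ Dt Ds st; rewrite /y; lra.
  have {}st : s < t by rewrite lt_neqAle st andbT; apply/eqP => e; exact: ts.
  rewrite indicE memNset/=; last first.
    by rewrite in_itv/=; apply/negP; rewrite -leNgt ltW.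
  apply: kuhn_cvg0; have /andP[_ ->] := y01 t.
  by have := cosk_mono _ _ Ds Dt st; rewrite /y andbT; lra.
- move=> n t _; apply: sqrB_le1; last by rewrite kuhn_ge0 ?kuhn_le1.
  by rewrite indicE; case: (_ \in _); rewrite ?lexx ?ler01.
Qed.

Lemma cos_approx_indic (A : set R) : measurable A -> cos_approx (\1_A : R -> R).
Proof.
have GE : @measurable _ (measurableTypeR R) = <<s @RGenInftyO.G R >>.
  exact: RGenInftyO.measurableE.
move=> mA; have {}mA : <<s @RGenInftyO.G R >> A by rewrite -GE.
apply: (@dynkin_induction _ (measurableTypeR R) _
  (fun A => cos_approx (\1_A : R -> R)) GE _ _ _ _ _ A mA).
- move=> _ _ [a ->] [b ->]; exists (Num.min a b).
  apply/seteqP; split => x /=; rewrite !in_itv/= lt_min.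
    by move=> [-> ->].
  by move=> /andP[].
- rewrite (_ : \1__ = (fun=> 1)); first exact/cos_approx_cpoly/cpoly_cst.
  by apply/funext => t; rewrite indicT.
- by move=> _ [a ->]; exact: cos_approx_ray.
- move=> B mB aB; rewrite (_ : \1__ = (fun t => 1 + (-1) * \1_B t)).
    apply: cos_approxD; [exact/cpoly_inL2/cpoly_cst|exact/inL2Z/inL2_indic| |].
      exact/cos_approx_cpoly/cpoly_cst.
    by apply: cos_approxZ => //; exact: inL2_indic.
  apply/funext => t; rewrite !indicE in_setC; case: (_ \in _) => /=.
    by rewrite mulr1 subrr.
  by rewrite mulr0 addr0.
- move=> F mF tF aF.
  have mUF : measurable (\bigcup_k F k) by exact: bigcupT_measurable.
  (* By disjointness these partial sums are 0 or 1, hence dominated, and they are eventually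
     constant at each point. *)
  pose S n t : R := \sum_(k < n) \1_(F k) t.
  have SE t : (exists k0, (forall n, S n t = (k0 < n)%N%:R) /\
        \1_(\bigcup_k F k) t = 1 :> R) \/
      ((forall n, S n t = 0) /\ \1_(\bigcup_k F k) t = 0 :> R).
    have [[k0 Fk0]|nF] := pselect (exists k, F k t); [left; exists k0|right]; split.
    - move=> n; have Fk (k : 'I_n) : \1_(F k) t = (k == k0 :> nat)%:R :> R.
        rewrite indicE; have [->|kk] := eqVneq (k : nat) k0; first by rewrite mem_set.
        rewrite memNset// => Fkt; move/eqP : kk; apply.
        by apply: (tF k k0 I I); exists t.
      rewrite /S; under eq_bigr do rewrite Fk.
      have [h|h] := ltnP k0 n.
        rewrite (bigD1 (Ordinal h))//= eqxx big1 ?addr0// => k kk.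
        rewrite (_ : _ == _ = false)//; apply/negbTE; move: kk; apply: contra.
        by move=> /eqP kk; apply/eqP/val_inj.
      rewrite big1// => k _; rewrite (_ : _ == _ = false)//.
      by apply/negbTE; rewrite neq_ltn (leq_trans (ltn_ord k) h).
    - by rewrite indicE mem_set//; exists k0.
    - move=> n; rewrite /S big1// => k _; rewrite indicE memNset// => Fkt.
      by apply: nF; exists k.
    - by rewrite indicE memNset// => -[k _ Fkt]; apply: nF; exists k.
  apply: (@cos_approx_seq _ S (cst 1)) => //.
  + exact: inL2_indic.
  + by move=> n; apply: inL2_sum => k; exact: (inL2_indic (mF k)).
  + by move=> n; apply: cos_approx_sum => k; [exact: (inL2_indic (mF k))|exact: aF].
  + apply: aeW => t _; have [[k0 [Sn ->]]|[Sn ->]] := SE t.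
      by apply: cvg_near_cst; exists k0.+1 => // n /= kn; rewrite Sn kn.
    by apply: cvg_near_cst; apply: nearW => n; rewrite Sn.
  + move=> n t _; have [[k0 [-> ->]]|[-> ->]] := SE t; apply: sqrB_le1;
      rewrite ?lexx ?ler01//.
    by case: (_ < _)%N; rewrite ?lexx ?ler01.
Qed.

Lemma cos_approx_ge0 u : measurable_fun setT u -> (forall t, 0 <= u t) ->
  inL2 T u -> cos_approx u.
Proof.
move=> mu1 u0 Lu; have [f [sf f0 fu nd cf]] := simple_approx mu1 u0.
have Lf n : inL2 T (f n).
  have [K fK] := simple_form_bounded (sf n); apply: (@inL2_bounded _ K) => //.
  by apply: measurable_funTS; exact: simple_form_measurable.
have af n : cos_approx (f n).
  have [s [A [mA /funext ->]]] := sf n.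
  apply: cos_approx_sum => y; first exact/inL2Z/inL2_indic.
  by apply: cos_approxZ; [exact: inL2_indic|exact: cos_approx_indic].
apply: (@cos_approx_seq _ f (fun t => u t ^+ 2)) => //.
- by apply: aeW => t _; exact: cf.
- by case: Lu.
- move=> n t _; rewrite lerXn2r ?nnegrE// ?subr_ge0//.
  by rewrite lerBlDr lerDl.
Qed.

Lemma eq_cos_approx u v : {in D, u =1 v} -> cos_approx u -> cos_approx v.
Proof.
move=> uv au e /au[g cg ug]; exists g => //; rewrite (le_trans _ ug)// /dist2.
by rewrite le_eqVlt; apply/orP; left; apply/eqP/eq_Rintegral => t /uv ->.
Qed.

Lemma inL2_cos_approx u : inL2 T u -> cos_approx u.
Proof.
move=> [mu1 iu]; pose u' := u \_ D.
have mu' : measurable_fun setT u' by apply/(measurable_restrictT _ _).1.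
have u'E : {in D, u' =1 u} by move=> t tD; rewrite /u' patchE tD.
pose up t := Num.max (u' t) 0; pose um t := Num.max (- u' t) 0.
have mup : measurable_fun setT up by apply: measurable_maxr.
have mum : measurable_fun setT um.
  by apply: measurable_maxr => //; exact: measurableT_comp.
have up0 t : 0 <= up t by rewrite le_max lexx orbT.
have um0 t : 0 <= um t by rewrite le_max lexx orbT.
have Lp (w : R -> R) : measurable_fun setT w ->
    (forall t, `|w t| <= `|u' t|) -> inL2 T w.
  move=> mw wu; split; first exact: measurable_funTS.
  apply: le_integrable iu => //.
    by apply/measurable_EFinP; apply: measurable_funX; exact: measurable_funTS.
  move=> t Dt; rewrite /= lee_fin !normrX lerXn2r ?nnegrE//.
  by rewrite -(u'E t) ?inE.
have Lup : inL2 T up.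
  by apply: Lp => // t; rewrite /up; case: (leP (u' t) 0) => h; rewrite ?normr0.
have Lum : inL2 T um.
  apply: Lp => // t; rewrite /um; case: (leP (- u' t) 0) => h; first by rewrite normr0.
  by rewrite normrN.
have := cos_approxD Lup (inL2Z (-1) Lum) (cos_approx_ge0 mup up0 Lup)
  (cos_approxZ (-1) Lum (cos_approx_ge0 mum um0 Lum)).
apply: eq_cos_approx => t tD; rewrite -(u'E t tD) /up /um mulN1r.
by case: (leP (u' t) 0) => h; case: (leP (- u' t) 0) => h'; lra.
Qed.

Lemma L2ip_sumr u N b : inL2 T u ->
  L2ip T u (cos_poly T N b) = \sum_(k < N) b k * L2ip T u (cons_basis T k).
Proof.
move=> Lu; rewrite /L2ip.
have iu k : mu.-integrable D (EFin \o (fun t => u t * cons_basis T k t)).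
  by apply: inL2_int2 => //; apply: inL2_lipb; exact: lipb_cons_basis.
transitivity (\int[mu]_(t in D) \sum_(k < N) b k * (u t * cons_basis T k t)).
  apply: eq_Rintegral => t _; rewrite /cos_poly mulr_sumr.
  by apply: eq_bigr => k _; rewrite mulrCA.
rewrite Rintegral_sum//; last by move=> k; apply: integrableZ_EFin.
by apply: eq_bigr => k _; rewrite RintegralZl.
Qed.

(** Completing the square in [b] separates the deficit in Bessel's inequality from the error in the
    coefficients. *)
Lemma dist2_cos_poly u N b : inL2 T u ->
  dist2 u (cos_poly T N b) = L2ip T u u -
    \sum_(k < N) L2ip T u (cons_basis T k) ^+ 2 +
    \sum_(k < N) (L2ip T u (cons_basis T k) - b k) ^+ 2.
Proof.
move=> Lu; have Lg : inL2 T (cos_poly T N b) by apply: inL2_lipb; exact: lipb_cos_poly.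
have i1 := inL2_int2 Lu Lu; have i2 := inL2_int2 Lu Lg; have i3 := inL2_int2 Lg Lg.
have gg : \int[mu]_(t in D) (cos_poly T N b t * cos_poly T N b t) =
    \sum_(k < N) b k ^+ 2.
  have [F dF <-] := cos_poly_primitive T0 N b.
  have cg : continuous (fun t => cos_poly T N b t ^+ 2).
    by apply: continuous_lipb; apply: lipbM; exact: lipb_cos_poly.
  by rewrite /Rintegral (integral_is_derive T0 dF cg).
have -> : dist2 u (cos_poly T N b) = L2ip T u u + (-2) * L2ip T u (cos_poly T N b)
    + \sum_(k < N) b k ^+ 2.
  rewrite -gg /L2ip /dist2 -RintegralZl// -RintegralD//; last exact: integrableZ_EFin.
  rewrite -RintegralD//; last by apply: integrableD_EFin => //; exact: integrableZ_EFin.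
  by apply: eq_Rintegral => t _; ring.
rewrite L2ip_sumr// -!addrA; congr (_ + _).
rewrite mulr_sumr -sumrN -!big_split/=; apply: eq_bigr => k _; ring.
Qed.

(** In [dist2_cos_poly], the Fourier coefficients as [b] show that the deficit is nonnegative, and
    the coefficients of an approximating polynomial show that it is small. *)
Lemma parseval u : inL2 T u ->
  \sum_(k < N) L2ip T u (cons_basis T k) ^+ 2 @[N --> \oo] --> L2ip T u u.
Proof.
move=> Lu; apply/cvgrPdist_le => e e0.
have [g [N0 gN] ug] := inL2_cos_approx Lu e0; exists N0 => // N /= N0N.
have [b /funext gb] := gN N N0N.
have d0 : 0 <= L2ip T u u - \sum_(k < N) L2ip T u (cons_basis T k) ^+ 2.
  have := dist2_cos_poly N (fun k => L2ip T u (cons_basis T k)) Lu.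
  rewrite [X in _ = _ + X]big1; last by move=> k _; rewrite subrr expr0n.
  by rewrite addr0 => <-; apply: Rintegral_ge0 => t _; rewrite sqr_ge0.
rewrite ger0_norm//; apply: le_trans ug; rewrite gb dist2_cos_poly// lerDl.
by apply: sumr_ge0 => k _; rewrite sqr_ge0.
Qed.

End CosineDense.

(** * Limits of Gaussian moments *)

Section GaussianMoments.
Context d (Omega : measurableType d) (R : realType) (P : probability Omega R).
Implicit Types Y : Omega -> R.

(** Gaussian as far as moments are concerned; the degenerate variance 0 is included. *)
Definition gauss_moments (v : R) Y :=
  all_moments P Y /\ forall m, \int[P]_w (Y w ^+ m) = gaussm v m.

Lemma gaussm_cvg (v_ : nat -> R) (v : R) m : v_ n @[n --> \oo] --> v ->
  gaussm (v_ n) m @[n --> \oo] --> gaussm v m.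
Proof.
move=> cv; rewrite /gaussm; case: ifP => _; first exact: cvg_cst.
apply: cvgM; first exact: cvg_cst.
elim: m./2 => [|k IH].
  by rewrite expr0; under eq_fun do rewrite expr0; exact: cvg_cst.
by rewrite exprS; under eq_fun do rewrite exprS; exact: cvgM.
Qed.

(** The second moment of Y_n^m is the Gaussian moment of order 2m, a polynomial in v_n, hence
    bounded along a convergent sequence of variances. *)
Lemma gauss_limit (Y_ : nat -> Omega -> R) Y (v_ : nat -> R) (v : R) :
  (forall n, gauss_moments (v_ n) (Y_ n)) -> v_ n @[n --> \oo] --> v ->
  measurable_fun setT Y -> {ae P, forall w, Y_ n w @[n --> \oo] --> Y w} ->
  gauss_moments v Y.
Proof.
move=> gY cv mY cY.
suff h m : P.-integrable setT (EFin \o (fun w => Y w ^+ m)) /\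
    \int[P]_w (Y w ^+ m) = gaussm v m.
  by split=> [|m]; [split=> // m|]; have [] := h m.
have LYm n : all_moments P (fun w => Y_ n w ^+ m).
  by apply: all_momentsX; have [] := gY n.
have [K KP] : exists K, forall n, \int[P]_w ((Y_ n w ^+ m) ^+ 2) <= K.
  have h1 := @gaussm_cvg _ _ (m * 2)%N cv.
  have /cvg_seq_bounded := cvgP _ h1.
  move=> [M [_ /(_ (M + 1))]]; rewrite ltrDl ltr01 => /(_ isT) h.
  exists (M + 1) => n; under eq_Rintegral do rewrite -exprM.
  have [_ ->] := gY n; exact: (le_trans (ler_norm _) (h n I)).
have mYm : measurable_fun setT (fun w => Y w ^+ m) by exact: measurable_funX.
have cYm : {ae P, forall w, Y_ n w ^+ m @[n --> \oo] --> Y w ^+ m}.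
  apply: filterS cY => w h; elim: m {LYm K KP mYm} => [|k IH].
    by rewrite expr0; under eq_fun do rewrite expr0; exact: cvg_cst.
  by rewrite exprS; under eq_fun do rewrite exprS; exact: cvgM.
have [iY cI] := cvg_expectation_L2_bounded LYm mYm cYm KP.
split=> //; apply: (cvg_unique _ cI) => //.
rewrite (_ : (fun n => _) = (fun n => gaussm (v_ n) m)); first exact: gaussm_cvg.
by apply/funext => n; have [_ ->] := gY n.
Qed.

End GaussianMoments.

(** * Almost sure convergence by a fourth-moment maximal inequality *)

Section AlmostSureConvergence.
Context d (Omega : measurableType d) (R : realType) (P : probability Omega R).
Variables (Z : nat -> Omega -> R) (c : nat -> R).
Hypothesis gZ : forall N (b : nat -> R), gauss_moments P (\sum_(k < N) b k ^+ 2)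
  (fun w => \sum_(k < N) b k * Z k w).

Let W N w := \sum_(k < N) c k * Z k w.
Let V a n := \sum_(k < n) c (a + k)%N ^+ 2.

Let W_moments N : all_moments P (W N).
Proof. by have [] := gZ N c. Qed.

Let V_ge0 a n : 0 <= V a n.
Proof. by apply: sumr_ge0 => k _; rewrite sqr_ge0. Qed.

Let VD a n m : V a (n + m) = V a n + V (a + n) m.
Proof.
rewrite /V big_split_ord/=; congr (_ + _).
by apply: eq_bigr => k _; rewrite addnA.
Qed.

Let Wdiff a n : gauss_moments P (V a n) (fun w => W (a + n) w - W a w).
Proof.
have := gZ (a + n) (fun k => if (k < a)%N then 0 else c k).
rewrite big_split_ord/= big1 ?add0r; last by move=> k _; rewrite ltn_ord expr0n.
rewrite (_ : \sum_(k < n) _ = V a n); last first.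
  by apply: eq_bigr => k _; rewrite ltnNge leq_addr.
congr (gauss_moments P _ _); apply/funext => w.
rewrite /W !big_split_ord/= big1 ?add0r; last by move=> k _; rewrite ltn_ord mul0r.
rewrite addrAC subrr add0r; apply: eq_bigr => k _.
by rewrite ltnNge leq_addr.
Qed.

(** Applying (p + q)^2 <= 8/7 q^2 + 8 p^2 twice gives the coefficients (8/7)^3 = 512/343 <= 3/2 and
    8^3 = 512. Any coefficient of y^4 below 2 would let the chaining contract. *)
Let fourth_const : {C : R | 0 <= C /\
  forall x y : R, (x + y) ^+ 4 <= 3 / 2 * y ^+ 4 + C * x ^+ 4}.
Proof.
exists 512; split=> [|x y]; first by rewrite ler0n.
have sq (p q : R) : (p + q) ^+ 2 <= 8 / 7 * q ^+ 2 + 8 * p ^+ 2.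
  rewrite -subr_ge0 (_ : _ - _ = 7^-1 * (q - 7 * p) ^+ 2); last by field.
  by rewrite mulr_ge0// sqr_ge0.
have xx := sqr_ge0 x; have yy := sqr_ge0 y.
have h1 := sq x y.
have h2 : (x + y) ^+ 4 <= (8 / 7 * y ^+ 2 + 8 * x ^+ 2) ^+ 2.
  rewrite (exprM _ 2 2) lerXn2r ?nnegrE ?sqr_ge0//.
  by move: xx yy; lra.
apply: (le_trans h2); rewrite addrC; apply: (le_trans (sq _ _)).
rewrite (exprM y 2 2) (exprM x 2 2); have := sqr_ge0 (y ^+ 2).
by have := sqr_ge0 (x ^+ 2); nra.
Qed.

Let C := sval fourth_const.

Let C0 : 0 <= C. Proof. by case: (svalP fourth_const). Qed.

Let fourth (x y : R) : (x + y) ^+ 4 <= 3 / 2 * y ^+ 4 + C * x ^+ 4.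
Proof. by case: (svalP fourth_const). Qed.

Let CK : 0 <= 12 * C. Proof. exact: mulr_ge0. Qed.

(* Chaining: split the block where half of the variance has been used up, and
   apply the induction hypothesis to the two pieces; the exponent 4 makes the
   constant contract by 3/4. *)
Let maximal n a : exists M : Omega -> R,
  [/\ P.-integrable setT (EFin \o M),
      forall w, 0 <= M w,
      forall w j, (j <= n)%N -> (W (a + j) w - W a w) ^+ 4 <= M w &
      \int[P]_w M w <= 12 * C * V a n ^+ 2].
Proof.
elim/ltn_ind: n a => n IH a; case: n IH => [|n] IH.
  exists (cst 0); split => //.
  - exact: (finite_measure_integrable_cst _ 0).
  - by move=> w j; rewrite leqn0 => /eqP ->; rewrite addn0 subrr expr0n.
  - by rewrite Rintegral_cst// mul0r; apply: mulr_ge0 => //; exact: sqr_ge0.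
pose u := V a n.+1.
have ex : exists h, u / 2 <= V a h.+1.
  by exists n; rewrite -/u ler_pdivrMr// ler_peMr ?ler1n//; exact: V_ge0.
pose h := ex_minn ex.
have [hu hmin] : u / 2 <= V a h.+1 /\ forall k, u / 2 <= V a k.+1 -> (h <= k)%N.
  by rewrite /h; case: ex_minnP.
have hn : (h <= n)%N.
  by apply: hmin; rewrite -/u ler_pdivrMr// ler_peMr ?ler1n//; exact: V_ge0.
(* By minimality of [h] the terms before index a + h carry at most half of the variance, as do those
   after it. The term at a + h itself may be large; it belongs to neither piece and is paid for by
   [Q]. *)
have Vh : V a h <= u / 2.
  case: h hmin {hu hn} => [|k] hmin; first by rewrite /V big_ord0 divr_ge0// V_ge0.
  by rewrite leNgt; apply/negP => /ltW /hmin; rewrite ltnn.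
have nE : n.+1 = (h.+1 + (n - h))%N by rewrite addSn subnKC.
have uE : u = V a h.+1 + V (a + h.+1) (n - h) by rewrite /u nE VD.
have Vr : V (a + h.+1) (n - h) <= u / 2 by move: uE hu; lra.
have hn1 : (h < n.+1)%N by rewrite ltnS.
have nh1 : (n - h < n.+1)%N by rewrite ltnS leq_subr.
have [M1 [iM1 M10 M1W M1I]] := IH h hn1 a.
have [M2 [iM2 M20 M2W M2I]] := IH (n - h)%N nh1 (a + h.+1)%N.
have [LD gD] := Wdiff a h.+1.
pose Q w := (W (a + h.+1) w - W a w) ^+ 4.
have iQ : P.-integrable setT (EFin \o Q) by have [_ ] := LD; exact.
have Q0 w : 0 <= Q w by rewrite /Q (exprM _ 2 2) sqr_ge0.
have QI : \int[P]_w Q w <= 3 * u ^+ 2.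
  rewrite /Q gD /gaussm/= /odd_dfact !big_ord_recl big_ord0/=.
  rewrite ler_wpM2l// lerXn2r ?nnegrE ?V_ge0//.
  by rewrite uE lerDl V_ge0.
(* The mean is at most 3/2 times 2 times 12 C u^2 / 4, plus 3 C u^2, which is 9 C u^2 + 3 C u^2.
   This is the origin of the constant 12. *)
exists (fun w => 3 / 2 * (M1 w + M2 w) + C * Q w).
have i12 : P.-integrable setT (EFin \o (fun w => M1 w + M2 w)).
  exact: integrableD_EFin.
split.
- by apply: integrableD_EFin => //; exact: integrableZ_EFin.
- move=> w; have CQ : 0 <= C * Q w by rewrite mulr_ge0.
  by have := M10 w; have := M20 w; move: CQ; lra.
- move=> w j jn; have CQ : 0 <= C * Q w by rewrite mulr_ge0.
  have [jh|hj] := leqP j h.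
    by have := M1W w j jh; have := M10 w; have := M20 w; move: CQ; lra.
  have -> : W (a + j) w - W a w = (W (a + h.+1) w - W a w) +
      (W (a + j) w - W (a + h.+1) w) by ring.
  apply: (le_trans (fourth _ _)); rewrite -/(Q w) lerD2r ler_wpM2l//.
  have -> : (a + j = a + h.+1 + (j - h.+1))%N by rewrite -addnA subnKC.
  apply: (le_trans (M2W w (j - h.+1)%N _)); first by lia.
  by rewrite lerDr.
rewrite RintegralD//; [|exact: integrableZ_EFin|exact: integrableZ_EFin].
rewrite !RintegralZl// RintegralD//.
have V1 : V a h ^+ 2 <= (u / 2) ^+ 2 by rewrite lerXn2r ?nnegrE ?V_ge0// divr_ge0// V_ge0.
have V2 : V (a + h.+1) (n - h) ^+ 2 <= (u / 2) ^+ 2.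
  by rewrite lerXn2r ?nnegrE ?V_ge0// divr_ge0// V_ge0.
have u2 : (u / 2) ^+ 2 = u ^+ 2 / 4 by rewrite expr_div_n; field.
have {}QI := ler_wpM2l C0 QI.
have {}V1 := ler_wpM2l C0 V1; have {}V2 := ler_wpM2l C0 V2.
by move: M1I M2I QI V1 V2; rewrite u2 -/u; lra.
Qed.

Let Ex (e : R) a := \bigcup_j [set w | e < `|W (a + j) w - W a w|].

(** The failure of Cauchy's criterion written with countable operations, which makes the divergence
    set measurable. *)
Definition osc_set := \bigcup_m \bigcap_a Ex m.+1%:R^-1 a.

Let mW N : measurable_fun setT (W N).
Proof. by have [] := W_moments N. Qed.

Let mA e a j : measurable [set w | e < `|W (a + j) w - W a w|].
Proof.
rewrite -[X in measurable X]setTI.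
have m : measurable_fun setT (fun w => `|W (a + j) w - W a w|).
  by apply: measurableT_comp => //; apply: measurable_funB.
have := m measurableT `]e, +oo[%classic (measurable_itv _).
congr (measurable _); apply/seteqP; split => w /=.
  by rewrite in_itv/= andbT.
by rewrite in_itv/= andbT.
Qed.

Let mEx e a : measurable (Ex e a).
Proof. by apply: bigcupT_measurable => j; exact: mA. Qed.

Lemma measurable_osc_set : measurable osc_set.
Proof.
by apply: bigcupT_measurable => m; apply: bigcapT_measurable => a; exact: mEx.
Qed.

Lemma cvg_osc_setP w : ~ osc_set w <-> cvgn (fun N => \sum_(k < N) c k * Z k w).
Proof.
split=> [nw|cw].
  apply: cauchy_real_cvg => e e0.
  pose m := Num.truncn (2 / e); have me : m.+1%:R^-1 <= e / 2.
    have m0 : 0 < m.+1%:R :> R by [].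
    rewrite -[leRHS]invrK lef_pV2 ?posrE// ?invr_gt0 ?divr_gt0// invf_div.
    by apply: ltW; exact: truncnS_gt.
  have [a Na] : exists a, ~ Ex m.+1%:R^-1 a w.
    by apply: contrapT => h; apply: nw; exists m => // a _; apply: contrapT => Na;
      apply: h; exists a.
  have close n : (a <= n)%N -> `|W n w - W a w| <= e / 2.
    move=> an; rewrite leNgt; apply/negP => h; apply: Na; exists (n - a)%N => //=.
    by rewrite subnKC//; exact: le_lt_trans h.
  exists a => n n' an an'.
  have -> : W n w - W n' w = (W n w - W a w) - (W n' w - W a w) by ring.
  by rewrite (splitr e) (le_trans (ler_normB _ _))// lerD// close.
move=> [m _ /= h].
move: cw => /cvg_ex[l /cvgrPdist_lt cl].
have [|N _ NP] := cl (m.+1%:R^-1 / 2); first by rewrite divr_gt0.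
have [j _ /=] := h N I; apply/negP; rewrite -leNgt.
have -> : W (N + j) w - W N w = (l - W N w) - (l - W (N + j) w) by ring.
rewrite [leRHS]splitr (le_trans (ler_normB _ _))// lerD// ltW// NP//=.
exact: leq_addr.
Qed.

(** The maximal inequality does not depend on the length of the block, so Markov's inequality bounds
    the probability of [Ex e a] by a multiple of the squared tail of the variances, which tends to 0
    with a. *)
Lemma osc_set_null (S : R) :
  \sum_(k < N) c k ^+ 2 @[N --> \oo] --> S -> P osc_set = 0%E.
Proof.
move=> cS.
have VS a n : V a n <= S - V 0 a.
  rewrite lerBrDl (_ : V 0 a + V a n = V 0 (a + n)); last by rewrite VD.
  rewrite -(cvg_lim _ cS)//; apply: (nondecreasing_cvgn_le _ _ (a + n)).
    by move=> p q pq; rewrite -(subnKC pq) VD lerDl V_ge0.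
  by apply/cvg_ex; exists S.
have PEx e a : 0 < e -> (P (Ex e a) <= (12 * C * (S - V 0 a) ^+ 2 / e ^+ 4)%:E)%E.
  move=> e0; have e40 : 0 < e ^+ 4 by rewrite exprn_gt0.
  pose A j := [set w | e < `|W (a + j) w - W a w|].
  pose U n := \bigcup_(j in [set j | (j <= n)%N]) A j.
  have mU n : measurable (U n) by apply: bigcup_measurable => j _; exact: mA.
  have UE : \bigcup_n U n = Ex e a.
    apply/seteqP; split => w.
      by move=> [n _ [j _ Aj]]; exists j.
    by move=> [j _ Aj]; exists j => //; exists j => /=.
  have cU : P (U n) @[n --> \oo] --> P (Ex e a).
    rewrite -UE; apply: nondecreasing_cvg_mu => //.
      by rewrite UE; exact: mEx.
    by move=> p q pq; apply/subsetPset => w [j /= jp Aj]; exists j => //=; exact: leq_trans pq.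
  rewrite -(cvg_lim _ cU)//; apply: lime_le; first by apply/cvg_ex; eexists; exact: cU.
  apply: nearW => n; have [M [iM M0 MW MI]] := maximal n a.
  have iU : P.-integrable setT (EFin \o (\1_(U n) : Omega -> R)).
    by apply: integrable_indic.
  have le1 : e ^+ 4 * \int[P]_w (\1_(U n) w : R) <= \int[P]_w M w.
    rewrite -RintegralZl//; apply: le_Rintegral => //.
      exact: integrableZ_EFin.
    move=> w _; rewrite indicE; have [/set_mem [j /= jn Aj]|_] := boolP (w \in U n).
      rewrite mulr1; apply: le_trans (MW w j jn).
      rewrite (exprM e 2 2) (exprM _ 2 2) lerXn2r ?nnegrE ?sqr_ge0//.
      rewrite -[(W _ _ - _) ^+ 2]real_normK ?num_real// lerXn2r ?nnegrE ?(ltW e0)//.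
      exact: ltW.
    by rewrite mulr0.
  have -> : P (U n) = (\int[P]_w (\1_(U n) w : R))%:E.
    by rewrite EFin_Rintegral// integral_indic// setIT.
  rewrite lee_fin ler_pdivlMr// mulrC (le_trans le1)// (le_trans MI)//.
  rewrite ler_wpM2l// lerXn2r ?nnegrE ?V_ge0//.
  exact: (le_trans (V_ge0 a n) (VS a n)).
have tail0 : (S - V 0 a) ^+ 2 @[a --> \oo] --> (0 : R).
  under eq_fun do rewrite expr2.
  rewrite -(mulr0 (0 : R)) -(subrr S).
  by apply: cvgM; apply: cvgB => //; (try exact: cvg_cst); exact: cS.
have PB m : P (\bigcap_a Ex m.+1%:R^-1 a) = 0%E.
  apply/eqP; rewrite eq_le measure_ge0 andbT; apply/lee_addgt0Pr => de de0.
  rewrite add0e; set e : R := m.+1%:R^-1; have e0 : 0 < e by rewrite invr_gt0.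
  have e40 : 0 < e ^+ 4 by rewrite exprn_gt0.
  have K1 : 0 < 12 * C + 1 by rewrite ltr_wpDl.
  have de1 : 0 < de * e ^+ 4 / (12 * C + 1) by rewrite divr_gt0// mulr_gt0.
  have /cvgrPdist_le/(_ _ de1)[a _ /(_ a (leqnn a))] := tail0.
  rewrite /= sub0r normrN ger0_norm ?sqr_ge0// => ha.
  apply: (@le_trans _ _ (P (Ex e a))).
    apply: le_measure; rewrite ?inE//; last by move=> w; apply.
    by apply: bigcapT_measurable => a'; exact: mEx.
  apply: (le_trans (PEx e a e0)); rewrite lee_fin ler_pdivrMr//.
  apply: (@le_trans _ _ ((12 * C + 1) * (S - V 0 a) ^+ 2)).
    by rewrite ler_wpM2r ?sqr_ge0// lerDl.
  by rewrite mulrC -ler_pdivlMr.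
apply/eqP; rewrite eq_le measure_ge0 andbT.
have mB m : measurable (\bigcap_a Ex m.+1%:R^-1 a).
  by apply: bigcapT_measurable => a; exact: mEx.
apply: (le_trans (measure_sigma_subadditive _ mB measurable_osc_set (fun w h => h))).
by rewrite eseries0// => m _ _; exact: PB.
Qed.

End AlmostSureConvergence.

(** * Mixed moments *)

Section JointMoments.
Context d (Omega : measurableType d) (R : realType) (P : probability Omega R).

(** The difference polynomial has degree below n and vanishes at the n points 0, ..., n-1, distinct
    in characteristic 0. *)
Lemma coef_eq_of_values n (f g : nat -> R) :
  (forall z : R, \sum_(k < n) f k * z ^+ k = \sum_(k < n) g k * z ^+ k) ->
  forall k, (k < n)%N -> f k = g k.
Proof.
move=> fg k kn; pose p := \poly_(i < n) (f i - g i).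
suff : p = 0.
  by move=> /polyP/(_ k); rewrite coef_poly kn coef0 => /eqP; rewrite subr_eq0 => /eqP.
apply: (@roots_geq_poly_eq0 _ p [seq i%:R | i <- iota 0 n]).
- apply/allP => x _; rewrite rootE horner_poly.
  under eq_bigr do rewrite mulrBl.
  by rewrite sumrB fg subrr.
- by rewrite map_inj_uniq ?iota_uniq// => i j /eqP; rewrite eqr_nat => /eqP.
- by rewrite size_map size_iota size_poly.
Qed.

Variables (n : nat) (W : 'I_n -> Omega -> R).
Hypothesis LW : forall j, all_moments P (W j).
Hypothesis gW : forall t : 'I_n -> R,
  gauss_moments P (\sum_j t j ^+ 2) (fun w => \sum_j t j * W j w).

Let A r (m : 'I_n -> nat) w := \prod_(j < n | (j < r)%N) W j w ^+ m j.
Let S r (t : 'I_n -> R) w := \sum_(j < n | (r <= j)%N) t j * W j w.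

Let LA r m : all_moments P (A r m).
Proof.
rewrite (_ : A r m = (fun w => \prod_(j < n) (if (j < r)%N then W j w ^+ m j else 1))).
  apply: (@all_moments_prod _ _ _ P _ _ (fun (j : 'I_n) w => if (j < r)%N then W j w ^+ m j else 1)) => j.
  by case: (j < r)%N; [exact: all_momentsX|exact: all_moments_cst].
by apply/funext => w; rewrite /A big_mkcond.
Qed.

Let LS r t : all_moments P (S r t).
Proof.
rewrite (_ : S r t = (fun w => \sum_(j < n) (if (r <= j)%N then t j * W j w else 0))).
  apply: (@all_moments_sum _ _ _ P _ _ (fun (j : 'I_n) w => if (r <= j)%N then t j * W j w else 0)) => j.
  by case: (r <= j)%N; [exact: all_momentsZ|exact: all_moments_cst].
by apply/funext => w; rewrite /S big_mkcond.
Qed.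

(* The variables are split off one at a time: both sides are polynomials in the
   coefficient t_r, and their coefficients are compared. *)
Let claim r : (r <= n)%N -> forall m t M,
  \int[P]_w (A r m w * S r t w ^+ M) =
  (\prod_(j < n | (j < r)%N) gaussm 1 (m j)) *
    gaussm (\sum_(j < n | (r <= j)%N) t j ^+ 2) M.
Proof.
elim: r => [|r IH] rn m t M.
  rewrite big_pred0// mul1r.
  have [_ gt] := gW t; rewrite -[RHS]gt.
  by apply: eq_Rintegral => w _; rewrite /A big_pred0// mul1r.
pose jr := Ordinal rn.
pose c : R := \prod_(j < n | (j < r)%N) gaussm 1 (m j).
pose s2 := \sum_(j < n | (r < j)%N) t j ^+ 2.
(* With this total exponent, the coefficient of z^(m r) in the N-th moment has exactly the M-th
   power of the remaining sum as cofactor. *)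
pose N := (m jr + M)%N.
have rE : (fun j : 'I_n => (r <= j)%N && (j != jr)) =1 (fun j => (r < j)%N).
  by move=> j; rewrite andbC -(inj_eq val_inj)/= ltn_neqAle eq_sym.
pose I k := \int[P]_w (A r m w * W jr w ^+ k * S r.+1 t w ^+ (N - k)).
have ik k : P.-integrable setT
    (EFin \o (fun w => A r m w * W jr w ^+ k * S r.+1 t w ^+ (N - k))).
  by apply: all_moments_int; apply: all_momentsM;
    [apply: all_momentsM|]; rewrite //; exact: all_momentsX.
have key z : \sum_(k < N.+1) 'C(N, k)%:R * I k * z ^+ k =
    \sum_(k < N.+1) 'C(N, k)%:R * (c * gaussm 1 k * gaussm s2 (N - k)) * z ^+ k.
  pose t' j := if j == jr then z else t j.
  have St' w : S r t' w = S r.+1 t w + z * W jr w.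
    rewrite /S (bigD1 jr)//= /t' eqxx addrC; congr (_ + _).
    rewrite (eq_bigl _ _ rE); apply: eq_bigr => j rj.
    by rewrite (_ : j == jr = false)//; apply/negbTE; rewrite -(inj_eq val_inj)/= gtn_eqF.
  have vt' : \sum_(j < n | (r <= j)%N) t' j ^+ 2 = z ^+ 2 * 1 + s2.
    rewrite (bigD1 jr)//= /t' eqxx mulr1; congr (_ + _).
    rewrite (eq_bigl _ _ rE); apply: eq_bigr => j rj.
    by rewrite (_ : j == jr = false)//; apply/negbTE; rewrite -(inj_eq val_inj)/= gtn_eqF.
  have := IH (ltnW rn) m t' N; rewrite vt' -gaussmD -/c => e.
  transitivity (\int[P]_w (A r m w * S r t' w ^+ N)).
    rewrite /I.
    transitivity (\int[P]_w (\sum_(k < N.+1) ('C(N, k)%:R * z ^+ k) *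
        (A r m w * W jr w ^+ k * S r.+1 t w ^+ (N - k)))).
      rewrite Rintegral_sum//; last by move=> k; apply: integrableZ_EFin.
      by apply: eq_bigr => k _; rewrite RintegralZl// mulrAC.
    apply: eq_Rintegral => w _; rewrite St' exprDn mulr_sumr.
    apply: eq_bigr => k _; rewrite -mulr_natl exprMn; ring.
  rewrite e mulr_sumr; apply: eq_bigr => k _; rewrite gaussmZ; ring.
have kN : (m jr < N.+1)%N by rewrite ltnS leq_addr.
have := @coef_eq_of_values N.+1 (fun k => 'C(N, k)%:R * I k)
  (fun k => 'C(N, k)%:R * (c * gaussm 1 k * gaussm s2 (N - k))) key _ kN.
have C0 : 'C(N, m jr)%:R != 0 :> R by rewrite pnatr_eq0 -lt0n bin_gt0 leq_addr.
move=> /(mulfI C0); rewrite /I /N addKn -/s2 => e.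
transitivity (\int[P]_w (A r m w * W jr w ^+ m jr * S r.+1 t w ^+ M)).
  apply: eq_Rintegral => w _; congr (_ * _).
  rewrite /A (bigD1 jr)//= mulrC; congr (_ * _); apply: eq_bigl => j.
  by rewrite ltnS -(inj_eq val_inj)/= ltn_neqAle andbC.
rewrite e; congr (_ * _).
rewrite (bigD1 jr (P := fun j : 'I_n => (j < r.+1)%N))//= mulrC; congr (_ * _).
by apply: eq_bigl => j; rewrite ltnS -(inj_eq val_inj)/= ltn_neqAle andbC.
Qed.

Lemma joint_moments (m : 'I_n -> nat) :
  \int[P]_w (\prod_j W j w ^+ m j) = \prod_j gaussm 1 (m j).
Proof.
have := claim (leqnn n) m (fun=> 0) 0%N.
have -> : \prod_(j < n | (j < n)%N) gaussm 1 (m j) = \prod_j gaussm 1 (m j) :> R.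
  by apply: eq_bigl => j; rewrite ltn_ord.
rewrite gaussm0 mulr1.
move=> <-; apply: eq_Rintegral => w _; rewrite expr0 mulr1 /A.
by apply: eq_bigl => j; rewrite ltn_ord.
Qed.

Lemma sum_even (f : nat -> R) p : (forall k, odd k -> f k = 0) ->
  \sum_(k < (2 * p).+1) f k = \sum_(s < p.+1) f (2 * s)%N.
Proof.
move=> f0; elim: p => [|p IH]; first by rewrite !big_ord_recl !big_ord0.
rewrite mulnS add2n big_ord_recr/= big_ord_recr/= IH f0 ?addr0; last first.
  by rewrite /= mul2n odd_double.
by rewrite [RHS]big_ord_recr/= mulnS add2n.
Qed.

Lemma joint_shifted_moments (a : 'I_n -> R) (p : 'I_n -> nat) (b : R) :
  \int[P]_w (\prod_j (a j + b * W j w) ^+ (2 * p j)) =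
  \prod_j \sum_(s < (p j).+1) ('C(2 * p j, 2 * s) * odd_dfact s)%:R *
    (b ^+ 2) ^+ s * a j ^+ (2 * p j - 2 * s).
Proof.
(* A common range for all exponents is required to expand the product of sums over functions from
   indices to exponents; the added terms vanish with their binomials. *)
pose B := \max_(j < n) (2 * p j).
have pB j : (2 * p j <= B)%N by exact: leq_bigmax.
pose co j (k : nat) := 'C(2 * p j, k)%:R * a j ^+ (2 * p j - k) * b ^+ k.
have widen (F : nat -> R) j : (forall k, (2 * p j < k)%N -> F k = 0) ->
    \sum_(k < B.+1) F k = \sum_(k < (2 * p j).+1) F k.
  move=> F0; have pB1 : ((2 * p j).+1 <= B.+1)%N by rewrite ltnS.
  rewrite [RHS](big_ord_widen _ F pB1).
  rewrite [RHS]big_mkcond/=; apply: eq_bigr => k _; case: ifPn => //.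
  by rewrite ltnS -ltnNge => /F0.
transitivity (\int[P]_w (\sum_(f : {ffun 'I_n -> 'I_B.+1})
    (\prod_j co j (f j)) * \prod_j W j w ^+ f j)).
  apply: eq_Rintegral => w _.
  transitivity (\prod_j \sum_(k < B.+1) co j k * W j w ^+ k).
    apply: eq_bigr => j _; rewrite (widen (fun k => co j k * W j w ^+ k) j); last first.
      by move=> k pk; rewrite /co bin_small// !mul0r.
    rewrite exprDn; apply: eq_bigr => k _; rewrite /co -mulr_natl exprMn; ring.
  rewrite (bigA_distr_bigA (fun j (k : 'I_B.+1) => co j k * W j w ^+ k)).
  by apply: eq_bigr => f _; rewrite big_split.
have iW (f : {ffun 'I_n -> 'I_B.+1}) :
    P.-integrable setT (EFin \o (fun w => \prod_j W j w ^+ f j)).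
  apply: all_moments_int; apply: (@all_moments_prod _ _ _ P _ _ (fun (j : 'I_n) w => W j w ^+ f j)) => j.
  exact: all_momentsX.
rewrite Rintegral_sum//; last by move=> f; apply: integrableZ_EFin => //; exact: iW.
transitivity (\prod_j \sum_(k < B.+1) co j k * gaussm 1 k).
  rewrite (bigA_distr_bigA (fun j (k : 'I_B.+1) => co j k * gaussm 1 k)).
  apply: eq_bigr => f _; rewrite RintegralZl//.
  by rewrite (joint_moments (fun j => f j)) -big_split.
apply: eq_bigr => j _; rewrite (widen (fun k => co j k * gaussm 1 k) j); last first.
  by move=> k pk; rewrite /co bin_small// !mul0r.
rewrite (sum_even (f := fun k => co j k * gaussm 1 k)); last first.
  by move=> k ok; rewrite /gaussm ok mulr0.
apply: eq_bigr => s _.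
have -> : gaussm 1 (2 * s) = (odd_dfact s)%:R :> R.
  by rewrite /gaussm mul2n odd_double/= doubleK expr1n mulr1.
by rewrite /co natrM -exprM; ring.
Qed.

End JointMoments.

(** * Paley-Wiener-Zygmund integrals of Brownian motion *)

Section WienerIntegrals.
Context {R : realType} (T : R).
Hypothesis T0 : 0 < T.
Context d (Omega : measurableType d) (P : probability Omega R).
Variables (X : Omega -> R -> R).
Hypothesis hX : is_wiener T P X.

Let RS_cvg_lipb phi x : lipb phi -> continuous x -> cvgn (RS_sum T phi x).
Proof. by move=> [L L0 [phiL _]] cx; exact: (RS_sum_cvg T0 L0 phiL cx). Qed.

Let cX w : continuous (X w).
Proof. by have [/(_ w)[]] := hX. Qed.

Lemma RS_sum_gauss phi N : gauss_moments P
  (\sum_(i < N) phi (i%:R * T / N%:R) ^+ 2 * (T / N%:R))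
  (fun w => RS_sum T phi (X w) N).
Proof.
have [_ mX hW] := hX.
pose t i : R := i%:R * T / N%:R.
pose xi i w := X w (t i.+1) - X w (t i).
have dt i : t i.+1 - t i = T / N%:R by rewrite /t -!mulrBl -natrB// subSnn mul1r.
have TN i : (i < N)%N -> 0 < T / N%:R by move=> iN; rewrite divr_gt0// ltr0n; exact: leq_ltn_trans iN.
have mxi i : measurable_fun setT (xi i) by apply: measurable_funB; exact: mX.
have sd0 i : (i < N)%N -> 0 < Num.sqrt (T / N%:R) by move=> iN; rewrite sqrtr_gt0; exact: TN iN.
have law (B : nat -> set R) : (forall i, measurable (B i)) ->
    P [set w | forall i, (i < N)%N -> B i (xi i w)] =
    (\prod_(i < N) normal_prob 0 (Num.sqrt (T / N%:R)) (B i))%E.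
  move=> mB.
  have t0 : t 0%N = 0 by rewrite /t !mul0r.
  have tS i : (i < N)%N -> t i < t i.+1.
    by move=> iN; rewrite -subr_gt0 dt; exact: TN iN.
  have tN : t N <= T.
    rewrite /t; have [->|N0] := eqVneq N 0%N; first by rewrite invr0 mulr0 ltW.
    by rewrite mulrC mulKf// pnatr_eq0.
  transitivity (\prod_(i < N) normal_prob 0 (Num.sqrt (t i.+1 - t i)) (B i))%E.
    exact: (hW N t B t0 tS tN mB).
  by apply: eq_bigr => i _; rewrite dt.
split.
  exact: (@increments_moments _ _ _ P N xi (fun=> Num.sqrt (T / N%:R))
    (fun i => phi (t i)) mxi sd0 law).
move=> m; rewrite /RS_sum.
have := @increments_momentE _ _ _ P N xi (fun=> Num.sqrt (T / N%:R))
    (fun i => phi (t i)) mxi sd0 law m.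
move=> ->; congr (gaussm _ _); apply: eq_bigr => i _.
by rewrite exprMn sqr_sqrtr// ltW// (TN i).
Qed.

Definition cos_coord k w := RS_int T (cons_basis T k) (X w).

Lemma RS_int_cvg k x : continuous x ->
  RS_sum T (cons_basis T k) x N @[N --> \oo] --> RS_int T (cons_basis T k) x.
Proof. by move=> cx; apply: RS_cvg_lipb => //; exact: lipb_cons_basis. Qed.

Lemma cvg_lin_comb (I : Type) (s : seq I) (b : I -> R) (f : I -> nat -> R) (l : I -> R) :
  (forall i, f i n @[n --> \oo] --> l i) ->
  \sum_(i <- s) b i * f i n @[n --> \oo] --> \sum_(i <- s) b i * l i.
Proof.
move=> fl; elim: s => [|i s IH].
  by rewrite big_nil; under eq_fun do rewrite big_nil; exact: cvg_cst.
rewrite big_cons; under eq_fun do rewrite big_cons.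
by apply: cvgD => //; apply: cvgM; [exact: cvg_cst|exact: fl].
Qed.

Lemma RS_cos_poly_cvg N b w : RS_sum T (cos_poly T N b) (X w) M @[M --> \oo] -->
  \sum_(k < N) b k * cos_coord k w.
Proof.
rewrite (_ : (fun M => _) = (fun M => \sum_(k < N) b k * RS_sum T (cons_basis T k) (X w) M)).
  by apply: cvg_lin_comb => k; exact: RS_int_cvg.
by apply/funext => M; exact: (@RS_sum_sum R T _ _ (fun k : 'I_N => b k)
  (fun k : 'I_N => cons_basis T k)).
Qed.

(** By linearity in the integrand, a combination of coordinates is the limit of the
    Riemann-Stieltjes sums of one cosine polynomial, so joint behaviour reduces to a single
    integrand. *)
Lemma cos_coord_gauss N (b : nat -> R) : gauss_moments P (\sum_(k < N) b k ^+ 2)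
  (fun w => \sum_(k < N) b k * cos_coord k w).
Proof.
apply: (@gauss_limit _ _ _ P (fun M w => RS_sum T (cos_poly T N b) (X w) M) _
  (fun M => \sum_(i < M) cos_poly T N b (i%:R * T / M%:R) ^+ 2 * (T / M%:R))).
- by move=> M; exact: RS_sum_gauss.
- exact: riemann_cos_poly.
- apply: (@measurable_fun_cvg _ _ _ setT (fun M w => RS_sum T (cos_poly T N b) (X w) M)).
    by move=> M; have [[]] := RS_sum_gauss (cos_poly T N b) M.
  by move=> w _; exact: RS_cos_poly_cvg.
- by apply: aeW => w; exact: RS_cos_poly_cvg.
Qed.

Definition PWZ_coef v k := L2ip T v (cons_basis T k).

Lemma PWZ_partialE v w :
  PWZ_partial T v (X w) = (fun N => \sum_(k < N) PWZ_coef v k * cos_coord k w).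
Proof. by []. Qed.

Definition PWZ_div v := osc_set cos_coord (PWZ_coef v).

Lemma measurable_PWZ_div v : measurable (PWZ_div v).
Proof. exact: measurable_osc_set cos_coord_gauss. Qed.

Lemma PWZ_divP v w : ~ PWZ_div v w <-> cvgn (PWZ_partial T v (X w)).
Proof. by rewrite PWZ_partialE; exact: cvg_osc_setP. Qed.

Lemma PWZ_div_null v : inL2 T v -> P (PWZ_div v) = 0%E.
Proof. by move=> Lv; apply: (osc_set_null cos_coord_gauss (parseval T0 Lv)). Qed.

Lemma PWZ_cvg v x : cvgn (PWZ_partial T v x) ->
  PWZ_partial T v x N @[N --> \oo] --> PWZ T v x.
Proof. by rewrite /PWZ; case: pselect. Qed.

(** Cut off on the divergence set, the partial sums converge everywhere, and their limit there is
    the default value 0. *)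
Lemma measurable_PWZ v : measurable_fun setT (fun w => PWZ T v (X w)).
Proof.
apply: (@measurable_fun_cvg _ _ _ setT
  (fun N w => PWZ_partial T v (X w) N * \1_(~` PWZ_div v) w)).
  move=> N; apply: measurable_funM.
    by have [[]] := cos_coord_gauss N (PWZ_coef v).
  by apply: measurable_indic; apply: measurableC; exact: measurable_PWZ_div.
move=> w _; rewrite indicE; have [h|h] := pselect (PWZ_div v w).
  rewrite memNset/=; last by move=> /(_ h).
  rewrite /PWZ; case: pselect => [cv|ncv]/=; first by have := (PWZ_divP v w).2 cv.
  by under eq_fun do rewrite mulr0; exact: cvg_cst.
by rewrite mem_set//=; under eq_fun do rewrite mulr1; apply: PWZ_cvg; exact/PWZ_divP.
Qed.

Lemma RS_int_shift k y w c : continuous y ->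
  RS_int T (cons_basis T k) (fun t => y t + c * X w t) =
  RS_int T (cons_basis T k) y + c * RS_int T (cons_basis T k) (X w).
Proof.
move=> cy; apply: cvg_lim => //.
rewrite (_ : RS_sum _ _ _ = (fun N => RS_sum T (cons_basis T k) y N +
    c * RS_sum T (cons_basis T k) (X w) N)); last by apply/funext => N; exact: RS_sumDx.
apply: cvgD; first exact: RS_int_cvg.
by apply: cvgM; [exact: cvg_cst|exact: RS_int_cvg].
Qed.

Lemma PWZ_shift v y w c : continuous y -> cvgn (PWZ_partial T v y) ->
  ~ PWZ_div v w ->
  PWZ T v (fun t => y t + c * X w t) = PWZ T v y + c * PWZ T v (X w).
Proof.
move=> cy cvy /PWZ_divP cvX.
have RSE k := @RS_int_shift k y w c cy.
have cv : PWZ_partial T v (fun t => y t + c * X w t) N @[N --> \oo] -->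
    PWZ T v y + c * PWZ T v (X w).
  rewrite (_ : PWZ_partial _ _ _ = (fun N => PWZ_partial T v y N +
      c * PWZ_partial T v (X w) N)); last first.
    apply/funext => N; rewrite /PWZ_partial mulr_sumr -big_split/=.
    by apply: eq_bigr => k _; rewrite RSE; ring.
  apply: cvgD; first exact: PWZ_cvg.
  by apply: cvgM; [exact: cvg_cst|exact: PWZ_cvg].
rewrite {1}/PWZ; case: pselect => [cv'|ncv]/=; first exact: cvg_lim.
by exfalso; apply: ncv; apply/cvg_ex; eexists; exact: cv.
Qed.

(** If the shifted series converged, subtracting the convergent series of [y] and dividing by [c]
    would make that of X w converge; so the default value applies. *)
Lemma PWZ_shift_div v y w c : c != 0 -> continuous y -> cvgn (PWZ_partial T v y) ->
  PWZ_div v w -> PWZ T v (fun t => y t + c * X w t) = 0.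
Proof.
move=> c0 cy cvy dw; rewrite /PWZ; case: pselect => // cvs; exfalso.
suff /PWZ_divP : cvgn (PWZ_partial T v (X w)) by [].
have RSE k := @RS_int_shift k y w c cy.
rewrite (_ : PWZ_partial T v (X w) = (fun N => c^-1 *
  (PWZ_partial T v (fun t => y t + c * X w t) N - PWZ_partial T v y N))).
  by apply: is_cvgM; [exact: is_cvg_cst|exact: is_cvgB].
apply/funext => N; rewrite /PWZ_partial -sumrB mulr_sumr.
by apply: eq_bigr => k _; rewrite RSE; field.
Qed.

End WienerIntegrals.

(** * Analytic continuation *)

Section RationalContinuation.
Lemma horner_cvg (K : numFieldType) (U : Type) (F : set_system U) {FF : Filter F}
    (f : U -> K) (a : K) (Q : {poly K}) :
  f x @[x --> F] --> a -> Q.[f x] @[x --> F] --> Q.[a].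
Proof.
move=> fa; elim/poly_ind: Q => [|p c IH].
  by rewrite horner0; under eq_fun do rewrite horner0; exact: cvg_cst.
rewrite hornerMXaddC; under eq_fun do rewrite hornerMXaddC.
by apply: cvgD; [exact: cvgM|exact: cvg_cst].
Qed.

(** With w = 1/z, the factorization Q - Q(w) = q (X - w) cancels the increment h: the quotient
    equals -q(1/(z+h)) w / (z+h), whose limit is plain continuity. *)
Lemma horner_inv_diff_quotient (K : numFieldType) (Q : {poly K}) (z : K) :
  z != 0 -> exists D : K,
  (Q.[(z + h)^-1] - Q.[z^-1]) / h @[h --> (0 : K)^'] --> D.
Proof.
move=> zN0; pose w := z^-1.
have : root (Q - Q.[w]%:P) w by rewrite rootE hornerD hornerN hornerC subrr.
move=> /factor_theorem[q qE].
exists (q.[w] * (- w) * w).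
have near_nz : \forall h \near (0 : K)^', h != 0 /\ z + h != 0.
  near=> h; split; first by near: h; exact: nbhs_dnbhs_neq.
  have hz : `|h| < `|z|.
    by near: h; apply: dnbhs0_lt; rewrite normr_gt0.
  apply/eqP => /eqP; rewrite addrC addr_eq0 => /eqP he.
  by move: hz; rewrite he normrN ltxx.
have qeq : {near (0 : K)^', (fun h => q.[(z + h)^-1] * (- w) * (z + h)^-1) =1
    (fun h => (Q.[(z + h)^-1] - Q.[z^-1]) / h)}.
  apply: filterS near_nz => h [h0 zh0].
  have -> : Q.[(z + h)^-1] - Q.[z^-1] = (Q - Q.[w]%:P).[(z + h)^-1].
    by rewrite hornerD hornerN hornerC.
  rewrite qE hornerM hornerXsubC -!mulrA; congr (_ * _).
  by rewrite /w; field; rewrite h0 zN0 zh0.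
apply: cvg_trans; first exact: (near_eq_cvg qeq).
have cz : z + h @[h --> (0 : K)^'] --> z.
  rewrite -[X in _ --> X]addr0; apply: cvgD; first exact: cvg_cst.
  exact: cvg_within.
have cw : (z + h)^-1 @[h --> (0 : K)^'] --> w by exact: cvgV.
apply: cvgM; last exact: cw.
by apply: cvgM; [exact: horner_cvg|exact: cvg_cst].
Unshelve. all: by end_near. Qed.

Context {R : realType}.
Local Notation C := (@Cx R).

Lemma analytic_horner_inv (Q : {poly C}) :
  analytic_on_Cplus (fun z : C => Q.[z^-1]).
Proof.
move=> z z0; apply: horner_inv_diff_quotient.
by apply/eqP => ze; move: z0; rewrite /Cplus/= ze ltxx.
Qed.

Lemma inv_minus_iq (q : R) : q != 0 -> (- iC * RtoC q)^-1 = iC / RtoC q :> C.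
Proof.
move=> q0; have qN0 : RtoC q != 0 :> C.
  by apply/eqP => /(congr1 (@complex.Re R))/= /eqP; rewrite (negbTE q0).
have ii : iC * iC = -1 :> C by apply/eqP; rewrite eq_complex /= !mul0r !mulr0 mul1r sub0r addr0 eqxx oppr0 eqxx.
have iN0 : iC != 0 :> C.
  by apply/eqP => /(congr1 (@complex.Im R))/= /eqP; rewrite oner_eq0.
rewrite invfM invrN; congr (_ / _).
by apply: (mulfI iN0); rewrite mulrN divff// ii.
Qed.

End RationalContinuation.

(** * Shifted stochastic integrals of an orthonormal family and the transform *)

Section MainTheorem.
Context {R : realType} (T : R).
Hypothesis T0 : 0 < T.
Context d (Omega : measurableType d) (P : probability Omega R).
Variables (X : Omega -> R -> R).
Hypothesis hX : is_wiener T P X.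
Variables (n : nat) (alpha : 'I_n -> R -> R).
Hypothesis halpha : L2orthonormal T alpha.

Let Lalpha j : inL2 T (alpha j). Proof. by have [] := halpha. Qed.

Lemma L2ip_suml (t : 'I_n -> R) v : inL2 T v ->
  L2ip T (fun s => \sum_j t j * alpha j s) v = \sum_j t j * L2ip T (alpha j) v.
Proof.
move=> Lv; rewrite /L2ip.
have iv j := inL2_int2 (Lalpha j) Lv.
transitivity (\int[lebesgue_measure]_(s in `[0, T]) \sum_j t j * (alpha j s * v s)).
  apply: eq_Rintegral => s _; rewrite mulr_suml.
  by apply: eq_bigr => j _; rewrite mulrA.
rewrite Rintegral_sum//; last by move=> j; apply: integrableZ_EFin => //; exact: iv.
by apply: eq_bigr => j _; rewrite RintegralZl//; exact: iv.
Qed.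

Lemma L2ip_comb (t : 'I_n -> R) :
  L2ip T (fun s => \sum_j t j * alpha j s) (fun s => \sum_j t j * alpha j s) =
  \sum_j t j ^+ 2.
Proof.
have Lu : inL2 T (fun s => \sum_j t j * alpha j s).
  by apply: inL2_sum => // j; exact: inL2Z.
rewrite L2ip_suml//; apply: eq_bigr => j _.
rewrite (_ : L2ip T (alpha j) _ = t j) ?expr2//.
rewrite /L2ip; under eq_Rintegral do rewrite mulrC.
rewrite -/(L2ip T _ (alpha j)) L2ip_suml// (bigD1 j)//= big1.
  by have [_ ->] := halpha; rewrite eqxx mulr1 addr0.
by move=> i ij; have [_ ->] := halpha; rewrite (negbTE ij) mulr0.
Qed.

Lemma PWZ_div_union : exists A, [/\ measurable A, P A = 0%E &
  forall j, PWZ_div T X (alpha j) `<=` A].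
Proof.
pose F (k : nat) : set Omega :=
  if insub k is Some j then PWZ_div T X (alpha j) else set0.
have mF k : measurable (F k).
  rewrite /F; case: insubP => [j _ _|_] //.
  exact: (measurable_PWZ_div T0 hX).
have mU : measurable (\bigcup_k F k) by exact: bigcupT_measurable.
exists (\bigcup_k F k); split => //.
  apply/eqP; rewrite eq_le measure_ge0 andbT.
  apply: (le_trans (measure_sigma_subadditive P mF mU (fun w h => h))).
  rewrite eseries0// => k _ _; rewrite /F; case: insubP => [j _ _|_] //.
  exact: (PWZ_div_null T0 hX).
by move=> j w dw; exists (val j) => //; rewrite /F valK.
Qed.

Let W j w := PWZ T (alpha j) (X w).

(** Linearity in the integrand is exact for partial sums, so they are taken for the single function
    u = sum_j t_j alpha_j; Parseval's identity for u and orthonormality give the limiting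
    variance. *)
Lemma PWZ_comb_gauss (t : 'I_n -> R) :
  gauss_moments P (\sum_j t j ^+ 2) (fun w => \sum_j t j * W j w).
Proof.
pose u s := \sum_j t j * alpha j s.
have Lu : inL2 T u by apply: inL2_sum => // j; exact: inL2Z.
have Le k : inL2 T (cons_basis T k) by apply: inL2_lipb => //; exact: lipb_cons_basis.
apply: (@gauss_limit _ _ _ P (fun N w => \sum_(k < N) PWZ_coef T u k * cos_coord T X k w)
  _ (fun N => \sum_(k < N) PWZ_coef T u k ^+ 2)).
- by move=> N; exact: (cos_coord_gauss T0 hX).
- by rewrite -L2ip_comb; exact: parseval.
- by apply: measurable_sum => j; apply: measurable_funM => //; exact: (measurable_PWZ T0 hX).
- have [A [mA PA0 subA]] := PWZ_div_union.
  exists A; split => // w /= h; apply: contrapT => nA; apply: h.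
  have cw j : PWZ_partial T (alpha j) (X w) N @[N --> \oo] --> W j w.
    by apply: PWZ_cvg; apply/PWZ_divP => /subA.
  rewrite (_ : (fun N => _) = (fun N => \sum_j t j * PWZ_partial T (alpha j) (X w) N)).
    by apply: cvg_lin_comb => j; exact: cw.
  apply/funext => N; rewrite /PWZ_partial.
  under [RHS]eq_bigr do rewrite mulr_sumr.
  rewrite exchange_big/=; apply: eq_bigr => k _.
  rewrite /PWZ_coef L2ip_suml// mulr_suml; apply: eq_bigr => j _.
  by rewrite mulrA.
Qed.

Let LW j : all_moments P (W j).
Proof.
have [+ _] := PWZ_comb_gauss (fun i => (i == j)%:R).
congr (all_moments P _); apply/funext => w.
rewrite (bigD1 j)//= eqxx mul1r big1 ?addr0// => i ij.
by rewrite (negbTE ij) mul0r.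
Qed.

Variable p : 'I_n -> nat.

Lemma shifted_PWZ_integral y b : C0 T y -> b != 0 ->
  (forall j, cvgn (PWZ_partial T (alpha j) y)) ->
  P.-integrable setT (EFin \o (fun w =>
    \prod_j PWZ T (alpha j) (fun t => y t + b * X w t) ^+ (2 * p j))) /\
  \int[P]_w (\prod_j PWZ T (alpha j) (fun t => y t + b * X w t) ^+ (2 * p j)) =
  \prod_j \sum_(s < (p j).+1) ('C(2 * p j, 2 * s) * odd_dfact s)%:R *
    (b ^+ 2) ^+ s * PWZ T (alpha j) y ^+ (2 * p j - 2 * s).
Proof.
move=> [cy _] b0 cvy.
pose a j := PWZ T (alpha j) y.
(* An identity at every w, the indicator reproducing the default value 0. It yields measurability
   and integrability; the indicator is dropped only almost surely, when the value of the integral is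
   computed. *)
have FE j w : PWZ T (alpha j) (fun t => y t + b * X w t) =
    (a j + b * W j w) * \1_(~` PWZ_div T X (alpha j)) w.
  rewrite indicE; have [dw|dw] := pselect (PWZ_div T X (alpha j) w).
    by rewrite (PWZ_shift_div T0 hX)// memNset ?mulr0//; apply.
  by rewrite (PWZ_shift T0 hX)// mem_set ?mulr1.
have mdiv j : measurable (~` PWZ_div T X (alpha j)).
  by apply: measurableC; exact: (measurable_PWZ_div T0 hX).
have L1 j : all_moments P (\1_(~` PWZ_div T X (alpha j)) : Omega -> R).
  split; first exact: measurable_indic.
  move=> m; apply: (@le_integrable _ _ _ P _ measurableT _ (EFin \o cst 1)) => //.
  - by apply/measurable_EFinP; apply: measurable_funX; exact: measurable_indic.
  - move=> w _; rewrite /= lee_fin normr1 normrX exprn_ile1// indicE.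
    by case: (_ \in _); rewrite ?normr1 ?normr0.
  - exact: (finite_measure_integrable_cst _ 1).
have La j : all_moments P (fun w => a j + b * W j w).
  by apply: all_momentsD; [exact: all_moments_cst|exact: all_momentsZ].
have LG : all_moments P (fun w =>
    \prod_j ((a j + b * W j w) * \1_(~` PWZ_div T X (alpha j)) w) ^+ (2 * p j)).
  apply: (@all_moments_prod _ _ _ P _ _ (fun j w =>
    ((a j + b * W j w) * \1_(~` PWZ_div T X (alpha j)) w) ^+ (2 * p j))) => j.
  by apply: all_momentsX; exact: all_momentsM.
have LH : all_moments P (fun w => \prod_j (a j + b * W j w) ^+ (2 * p j)).
  apply: (@all_moments_prod _ _ _ P _ _ (fun j w =>
    (a j + b * W j w) ^+ (2 * p j))) => j.
  exact: all_momentsX.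
have -> : (fun w => \prod_j PWZ T (alpha j) (fun t => y t + b * X w t) ^+ (2 * p j)) =
    (fun w => \prod_j ((a j + b * W j w) * \1_(~` PWZ_div T X (alpha j)) w) ^+ (2 * p j)).
  by apply/funext => w; apply: eq_bigr => j _; rewrite FE.
split; first exact: all_moments_int.
rewrite -(joint_shifted_moments LW PWZ_comb_gauss a p b).
apply: ae_eq_Rintegral => //; [by case: LG|by case: LH|].
have [A [mA PA0 subA]] := PWZ_div_union.
exists A; split => // w /= h; apply: contrapT => nA; apply: h => _.
apply: eq_bigr => j _; rewrite indicE mem_set ?mulr1//= => dw.
exact/nA/(subA j).
Qed.

Lemma PWZ_partial_scale (v x : R -> R) (c : R) : continuous x ->
  PWZ_partial T v (fun t => c * x t) = (fun N => c * PWZ_partial T v x N).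
Proof.
move=> cx; apply/funext => N; rewrite /PWZ_partial mulr_sumr; apply: eq_bigr => k _.
rewrite (_ : RS_int T _ (fun t => c * x t) = c * RS_int T (cons_basis T k) x); first by ring.
apply: cvg_lim => //.
rewrite (_ : RS_sum _ _ _ = (fun N => c * RS_sum T (cons_basis T k) x N)).
  by apply: cvgM; [exact: cvg_cst|exact: RS_int_cvg].
apply/funext => M; rewrite /RS_sum mulr_sumr.
by apply: eq_bigr => i _; ring.
Qed.

End MainTheorem.

Theorem theorem2 (R : realType) (T : R) (hT : 0 < T)
    (d : measure_display) (Omega : measurableType d)
    (P : probability Omega R) (X : Omega -> R -> R) (hX : is_wiener T P X)
    (n : nat) (alpha : 'I_n -> R -> R) (halpha : L2orthonormal T alpha)
    (p : 'I_n -> nat) (q : R) (hq : q != 0) :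
  FFT1_sae P X T
    (fun x => RtoC (\prod_(j < n) PWZ T (alpha j) x ^+ (2 * p j)))
    q
    (fun y => \prod_(j < n) \sum_(s < (p j).+1)
        (('C(2 * p j, 2 * s) * odd_dfact s)%:R : Cx)
        * (iC / RtoC q) ^+ s
        * RtoC (PWZ T (alpha j) y) ^+ (2 * p j - 2 * s)).
Proof.
(* Partial sums are homogeneous in the path, so the image of this set under a dilation still
   consists of paths with a divergent series. *)
exists [set y | C0 T y /\ exists j, ~ cvgn (PWZ_partial T (alpha j) y)]; split.
  move=> rho rho0; have [A [mA PA0 subA]] := PWZ_div_union hT hX halpha.
  exists A; split => //; split => // w [y [[cy _] [j ncv]] yX].
  apply: (subA j); apply: contrapT => /PWZ_divP cvX; apply: ncv.
  have -> : y = (fun t => rho^-1 * X w t).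
    by apply/funext => t; rewrite -yX mulKf// gt_eqF.
  rewrite (PWZ_partial_scale hT); last by have [/(_ w)[]] := hX.
  by apply: is_cvgM => //; exact: is_cvg_cst.
move=> y Cy Ny.
have cvy j : cvgn (PWZ_partial T (alpha j) y).
  by apply: contrapT => h; apply: Ny; split => //; exists j.
have sN0 lam : 0 < lam -> (Num.sqrt lam)^-1 != 0 :> R.
  by move=> lam0; rewrite invr_eq0 gt_eqF// sqrtr_gt0.
split.
  move=> lam lam0; split; first by have [] := shifted_PWZ_integral hT hX halpha p Cy (sN0 _ lam0) cvy.
  exact: (finite_measure_integrable_cst _ 0).
(* The shift b = lambda^(-1/2) enters only through b^2 = 1/lambda, so the integral is [Q] at
   1/lambda, a formula that makes sense for complex arguments. *)
pose Q : {poly Cx} := \prod_(j < n) \sum_(s < (p j).+1)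
  (('C(2 * p j, 2 * s) * odd_dfact s)%:R * RtoC (PWZ T (alpha j) y) ^+ (2 * p j - 2 * s)) *: 'X^s.
have QE (z : Cx) : Q.[z] = \prod_(j < n) \sum_(s < (p j).+1)
    ('C(2 * p j, 2 * s) * odd_dfact s)%:R * z ^+ s *
    RtoC (PWZ T (alpha j) y) ^+ (2 * p j - 2 * s).
  rewrite /Q horner_prod; apply: eq_bigr => j _.
  rewrite horner_sum; apply: eq_bigr => s _.
  by rewrite hornerZ hornerXn mulrAC.
exists (fun z => Q.[z^-1]); split.
- exact: analytic_horner_inv.
- move=> lam lam0; have [_ e] := shifted_PWZ_integral hT hX halpha p Cy (sN0 _ lam0) cvy.
  have -> : wint P X (fun x => RtoC (\prod_j PWZ T (alpha j)
      (fun t => y t + scale_path lam x t) ^+ (2 * p j))) =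
    RtoC (\int[P]_w (\prod_j PWZ T (alpha j)
      (fun t => y t + (Num.sqrt lam)^-1 * X w t) ^+ (2 * p j))).
    rewrite /wint /= Rintegral_cst// mul0r.
    by rewrite (_ : RtoC 0 = 0)// mulr0 addr0.
  rewrite e QE exprVn sqr_sqrtr ?(ltW lam0)//.
  rewrite -[RtoC]/(real_complex R) rmorph_prod/=; apply: eq_bigr => j _.
  rewrite rmorph_sum/=; apply: eq_bigr => s _.
  rewrite !rmorphM/=; congr (_ * _ * _).
  + by rewrite !rmorph_nat.
  + by rewrite rmorphXn/= fmorphV.
  + by rewrite rmorphXn.
(* The point -iq lies on the boundary of the half plane, but it is nonzero, so Q(1/z) is continuous
   there and the limit from within the half plane is its value. *)
- rewrite -inv_minus_iq// -QE; apply: horner_cvg; apply: cvgV.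
    rewrite mulf_neq0// ?oppr_eq0.
      by apply/eqP => /(congr1 (@complex.Im R))/= /eqP; rewrite oner_eq0.
    by apply/eqP => /(congr1 (@complex.Re R))/= /eqP; rewrite (negbTE hq).
  exact: cvg_within.
Qed.
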